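(* Let $N\ge 1$ and $m\ge 2$ be integers, let $r>0$, and assume that $p:=2r+1<p_B(N)$, where $p_B(1)=\infty$ and $p_B(N)=\frac{N(N+2)}{(N-1)^2}$ for $N\ge 2$. Let $B=(\beta_{ij})$ be a real symmetric $m\times m$ matrix such that $\beta_{ij}\ge 0$ for all $i\neq j$ and $\beta_{ii}>0$ for all $i$. Then the system $$\frac{\partial u_i}{\partial t}-\Delta u_i=\sum_{j=1}^m\beta_{ij}\,u_i^{r}u_j^{r+1},\qquad x\in\mathbb{R}^N,\ t\in\mathbb{R},\quad i=1,\dots,m,$$ has no nontrivial, nonnegative classical solution $U=(u_1,\dots,u_m)$ in $\mathbb{R}^N\times\mathbb{R}$.
   Context: $\Delta$ denotes the Laplacian in $x$. A classical solution has components $u_i$ that are $C^2$ in $x$ and $C^1$ in $t$ (i.e. of class $C^{2,1}$) and satisfies the equations pointwise. Nonnegative means $u_i\ge 0$ for every $i$; nontrivial means that $U$ is not identically $(0,\dots,0)$ (some components may vanish identically). *)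

(* Defs.v *)
From HB Require Import structures.
From mathcomp Require Import all_boot all_order all_algebra.
From mathcomp Require Import all_classical all_reals all_analysis.

Set Implicit Arguments.
Unset Strict Implicit.
Unset Printing Implicit Defensive.

Import Order.TTheory GRing.Theory Num.Theory.
Import numFieldNormedType.Exports.

Local Open Scope classical_set_scope.
Local Open Scope ring_scope.

Section SpaceTime.
Variables (R : realType) (N : nat).
Implicit Types (f : 'rV[R]_N -> R -> R) (x : 'rV[R]_N) (t : R).

Definition ebase (k : 'I_N) : 'rV[R]_N := delta_mx 0 k.

Definition dx (k : 'I_N) f : 'rV[R]_N -> R -> R :=
  fun x t => 'D_(ebase k) (fun y => f y t) x.

Definition dt f : 'rV[R]_N -> R -> R := fun x t => derive1 (f x) t.

Definition ex_dx (k : 'I_N) f : Prop :=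
  forall x t, derivable (fun y => f y t) x (ebase k).

Definition ex_dt f : Prop := forall x t, derivable (f x) t 1.

Definition laplacian f : 'rV[R]_N -> R -> R :=
  fun x t => \sum_(k < N) dx k (dx k f) x t.

Definition jcontinuous f : Prop :=
  continuous (fun z : 'rV[R]_N * R => f z.1 z.2).

(* The derivative operators are total, with unspecified values where the
   difference quotient does not converge, so existence is required apart from
   continuity.  Continuity is joint in (x, t). *)
Definition classC21 f : Prop :=
  [/\ jcontinuous f,
      ex_dt f /\ jcontinuous (dt f),
      forall k, ex_dx k f /\ jcontinuous (dx k f) &
      forall k l, ex_dx l (dx k f) /\ jcontinuous (dx l (dx k f))].

End SpaceTime.

Definition pB (R : realType) (N : nat) : \bar R :=
  if N == 1%N then +oo%E
  else ((N%:R * (N%:R + 2)) / (N%:R - 1) ^+ 2)%:E.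

Section System.
Variables (R : realType) (N m : nat).
Implicit Types (B : 'M[R]_m) (r : R) (u : 'I_m -> 'rV[R]_N -> R -> R).

Definition classical_solution r B u : Prop :=
  (forall i, classC21 (u i)) /\
  (forall i x t,
     dt (u i) x t - laplacian (u i) x t =
     \sum_(j < m) B i j * (u i x t `^ r) * (u j x t `^ (r + 1))).

Definition nonnegative u : Prop := forall i x t, 0 <= u i x t.

Definition nontrivial u : Prop := exists i x t, u i x t != 0.

End System.

(* Main.v *)
Require Import Defs.
From HB Require Import structures.
From mathcomp Require Import all_boot all_order all_algebra.
From mathcomp Require Import all_classical all_reals all_analysis.
From mathcomp Require Import ring lra zify.

(* The integral estimate behind the theorem goes back to Gidas-Spruck and
   Bidaut-Veron.  With p = 2r + 1, a cutoff phi and v = u_i + delta > 0, one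
   integrates phi |D^2 v - b v^-1 (grad v)(x)(grad v)|^2 >= phi (trace)^2 / N by
   parts, replaces the Laplacian by v_t - f_i - e, and uses the gradient structure
   f_i = d_i F through
     sum_i grad f_i . grad v_i <= p sum_i f_i |grad v_i|^2 / v_i.
   A suitable b exists exactly when p < p_B(N), and then the integral of
   phi sum_i v_i^(2p) over a parabolic box of size A is at most
   C A^(N + 2 - 4p/(p-1)), a negative power of A since p < p_B(N) < p_S(N).
   The shift by delta makes the maximum principle unnecessary (components may
   vanish up to some time when r < 1): v solves the system up to an error e that
   tends to 0 uniformly on the box as delta tends to 0.

   No integration theory is needed: "integral" means average over a fine lattice
   in the box, functions whose averages tend to 0 are "null", and discrete
   summation by parts shows that divergences are null.  This also avoids any
   derivative that a C^{2,1} function need not have.  All other steps are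
   pointwise Young inequalities. *)

Set Implicit Arguments.
Unset Strict Implicit.
Unset Printing Implicit Defensive.

Import Order.TTheory GRing.Theory Num.Theory.
Import numFieldNormedType.Exports.

Local Open Scope classical_set_scope.
Local Open Scope ring_scope.

(** * Directional calculus *)

Section Calculus.
Variables (R : realType) (E : normedModType R).
Implicit Types (d z : E) (f g : E -> R).

(** The time derivative is not of lower order: replacing the Laplacian leaves terms with v_t that no
    cutoff makes small. They are absorbed by the energy identity obtained on testing the equation
    with phi v_t. Since the sum of f_i (v_i)_t is the time derivative of the potential F, this
    identity supplies phi v_t^2 with any large factor at the cost of cutoff and error terms. The
    square f_i^2, which carries v_i^(2p), comes from the slack in p < p_B(N): the part of f_i |grad
    v_i|^2 / v_i that the gradient structure does not consume is traded for it. The order of choices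
    matters. The constants depend on N, m, r and B only; then come the box size A, the shift delta
    (depending on A), the mesh, and at the end A grows. Averages are normalized, so a fixed
    neighbourhood of a point where some u_i is positive contributes at least a multiple of
    A^(-(N+2)), which is compared with the upper bound C A^(-4p/(p-1)). *)

Lemma is_derive1_continuous (h : R -> R) (a b : R) :
  is_derive a 1 h b -> {for a, continuous h}.
Proof.
by move=> [dh _]; apply: differentiable_continuous; apply/derivable1_diffP.
Qed.

(** The derivative is carried as an explicit function, so that product and chain rules leave
    expressions for [ring] and [field]. Regularity is asked along [d] only, since a space derivative
    of a C^{2,1} function need not have a time derivative. *)
Definition C1along d f f' : Prop :=
  [/\ continuous f, continuous f' &
      forall z, is_derive (0 : R) 1 (fun s : R => f (z + s *: d)) (f' z)].

Lemma C1along_eq d f f1 f2 : C1along d f f1 -> f1 =1 f2 -> C1along d f f2.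
Proof. by move=> + /funext <-. Qed.

Lemma C1along_cst d (c : R) : C1along d (fun=> c) (fun=> 0).
Proof. by split=> [z|z|z]; [exact: cvg_cst|exact: cvg_cst|exact: is_derive_cst]. Qed.

Lemma C1alongD d f f' g g' : C1along d f f' -> C1along d g g' ->
  C1along d (fun z => f z + g z) (fun z => f' z + g' z).
Proof.
move=> [cf cf' df] [cg cg' dg]; split=> z.
- by apply: cvgD; [exact: cf|exact: cg].
- by apply: cvgD; [exact: cf'|exact: cg'].
- by have := df z; have := dg z => ? ?; apply: is_deriveD.
Qed.

Lemma C1alongM d f f' g g' : C1along d f f' -> C1along d g g' ->
  C1along d (fun z => f z * g z) (fun z => f' z * g z + f z * g' z).
Proof.
move=> [cf cf' df] [cg cg' dg]; split=> z.
- by apply: cvgM; [exact: cf|exact: cg].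
- by apply: cvgD; apply: cvgM; [exact: cf'|exact: cg|exact: cf|exact: cg'].
- have := df z; have := dg z => ? ?; apply: is_derive_eq.
  by rewrite scale0r addr0 /GRing.scale /=; ring.
Qed.

Lemma C1alongZ d (c : R) f f' : C1along d f f' ->
  C1along d (fun z => c * f z) (fun z => c * f' z).
Proof.
move=> Hf; apply: C1along_eq (C1alongM (C1along_cst d c) Hf) _ => z.
by rewrite mul0r add0r.
Qed.

Lemma C1along_sum d (I : Type) (s : seq I) (f f' : I -> E -> R) :
  (forall i, C1along d (f i) (f' i)) ->
  C1along d (fun z => \sum_(i <- s) f i z) (fun z => \sum_(i <- s) f' i z).
Proof.
move=> Hf; elim: s => [|i s IH].
  have := C1along_cst d 0; congr C1along; apply/funext => z; by rewrite big_nil.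
have := C1alongD (Hf i) IH; congr C1along; apply/funext => z; by rewrite big_cons.
Qed.

Lemma C1along_comp d f f' (h h' : R -> R) : C1along d f f' ->
  (forall z, is_derive (f z) 1 h (h' (f z))) ->
  (forall z, {for f z, continuous h'}) ->
  C1along d (fun z => h (f z)) (fun z => h' (f z) * f' z).
Proof.
move=> [cf cf' df] dh ch'; split=> z.
- apply: (@continuous_comp _ _ _ f h); first exact: cf.
  exact: is_derive1_continuous (dh z).
- apply: cvgM; last exact: cf'.
  by apply: (@continuous_comp _ _ _ f h'); [exact: cf|exact: ch'].
- have := df z => dfz.
  have := dh z; rewrite -[X in is_derive (f X)](addr0 z) -[X in is_derive (f (z + X))](scale0r d) => dhz.
  have H := @is_derive1_comp _ h (fun s => f (z + s *: d)) 0 _ _ dhz dfz.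
  by apply: is_derive_eq H _; rewrite // mulrC.
Qed.

Lemma C1along_shift d f f' : C1along d f f' ->
  forall z (s : R), is_derive s 1 (fun s : R => f (z + s *: d)) (f' (z + s *: d)).
Proof.
move=> [_ _ df] z s.
have H := df (z + s *: d).
have -> : (fun s : R => f (z + s *: d)) =
  (fun x => f (z + s *: d + x *: d)) \o (fun x => x - s).
  by apply/funext => x /=; rewrite -addrA -scalerDl addrC [s + _]addrC subrK addrC.
have H1 : is_derive (s - s) 1 (fun x : R => f (z + s *: d + x *: d)) (f' (z + s *: d)).
  by rewrite subrr.
have H2 : is_derive s 1 (fun x : R => x - s) (1 - 0) by apply: is_deriveB.
have := @is_derive1_comp _ _ (fun x => x - s) s _ _ H1 H2.
by rewrite subr0 mulr1.
Qed.

(** The sign of [h] is free because summation by parts produces backward differences. *)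
Lemma C1along_mvt d f f' z (h : R) : C1along d f f' ->
  exists2 t : R, `|t| <= `|h| & f (z + h *: d) - f z = h * f' (z + t *: d).
Proof.
move=> Hf.
have sh := C1along_shift Hf z.
have key (a b : R) : a <= b -> exists2 c, c \in `[a, b] &
    f (z + b *: d) - f (z + a *: d) = f' (z + c *: d) * (b - a).
  move=> ab; apply: (@MVT_segment _ (fun s => f (z + s *: d)) (fun s => f' (z + s *: d))).
  - exact: ab.
  - apply: continuous_in_subspaceT => y _.
    exact: is_derive1_continuous (sh y).
case: (leP 0 h) => h0.
  have [c] := key 0 h h0; rewrite in_itv/= => /andP[c0 ch].
  rewrite scale0r addr0 subr0 => ->; exists c; last by rewrite mulrC.
  by rewrite !ger0_norm.
have [c] := key h 0 (ltW h0); rewrite in_itv/= => /andP[c0 ch].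
rewrite scale0r addr0 sub0r => e; exists c; last first.
  by rewrite -opprB e mulrN opprK mulrC.
by rewrite !ler0_norm ?lerN2// ltW.
Qed.

(** The mean value theorem is applied along [d] to the increment of [f] by [h' *: d'], then along
    [d'] to [f']. No derivative of [f] along [d'] enters. *)
Lemma C1along_mvt2 d d' f f' f'' z (h h' : R) :
  C1along d f f' -> C1along d' f' f'' ->
  exists s t : R, [/\ `|s| <= `|h|, `|t| <= `|h'| &
    f (z + h *: d + h' *: d') - f (z + h *: d) - f (z + h' *: d') + f z
    = h * h' * f'' (z + s *: d + t *: d')].
Proof.
move=> Hf Hf'.
pose g y := f (y + h' *: d') - f y.
have Hg : C1along d g (fun y => f' (y + h' *: d') - f' y).
  have [cf cf' df] := Hf.
  have cs : continuous (fun y : E => y + h' *: d').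
    by move=> y; apply: cvgD; [exact: cvg_id|exact: cvg_cst].
  split=> y.
  - by apply: cvgB; [exact: (continuous_comp (cs y) (cf _))|exact: cf].
  - by apply: cvgB; [exact: (continuous_comp (cs y) (cf' _))|exact: cf'].
  - have H1 := df (y + h' *: d'); have H2 := df y.
    rewrite /g.
    have -> : (fun s : R => f (y + s *: d + h' *: d') - f (y + s *: d)) =
       (fun s : R => f (y + h' *: d' + s *: d)) - (fun s : R => f (y + s *: d)).
      by apply/funext => s; rewrite [RHS]/= addrAC.
    exact: is_deriveB.
have [s sh es] := C1along_mvt z h Hg.
have [t th et] := C1along_mvt (z + s *: d) h' Hf'.
exists s, t; split => //.
by rewrite -mulrA -et -es /g; ring.
Qed.

Lemma C1along_dir d (a : R) f f' : C1along d f f' ->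
  C1along (a *: d) f (fun z => a * f' z).
Proof.
move=> Hf; have [cf cf' df] := Hf; split=> // z.
  by apply: cvgM; [exact: cvg_cst|exact: cf'].
have -> : (fun s : R => f (z + s *: (a *: d))) = (fun s => f (z + s *: d)) \o (fun s => s * a).
  by apply/funext => s /=; rewrite scalerA.
have H1 : is_derive (0 * a) 1 (fun s : R => f (z + s *: d)) (f' z) by rewrite mul0r.
have H2 : is_derive (0 : R) 1 (fun s : R => s * a) a.
  have -> : (fun s : R => s * a) = a \*: id by apply/funext => s /=; rewrite mulrC.
  have := @is_deriveZ _ _ _ id a (0 : R) 1 1 (is_derive_id _ _).
  by rewrite /GRing.scale /= mulr1.
have H3 := @is_derive1_comp _ (fun s => f (z + s *: d)) (fun s => s * a) 0 _ _ H1 H2.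
by apply: is_derive_eq H3 _; rewrite mulrC.
Qed.

(** The same second difference of [f] equals [h * h] times either mixed derivative at some point
    near [z]; continuity of both closes the gap as [h] shrinks. *)
Lemma C1along_schwarz d d' f fd fd' fdd' fd'd z :
  C1along d f fd -> C1along d' fd fdd' -> C1along d' f fd' -> C1along d fd' fd'd ->
  fdd' z = fd'd z.
Proof.
move=> H1 H2 H3 H4.
have [_ c1 _] := H2; have [_ c2 _] := H4.
have close (g : E -> R) : continuous g -> forall e : R, 0 < e -> exists2 del : R, 0 < del &
    forall z', `|z' - z| < del -> `|g z' - g z| < e.
  move=> cg e e0; have /cvgrPdist_lt /(_ _ e0) := cg z.
  move=> /nbhs_ballP[del /= del0 hdel]; exists del => // z' hz'.
  by rewrite distrC; apply: hdel; rewrite -ball_normE /= distrC.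
apply/eqP; rewrite -subr_eq0 -normr_le0; apply/ler_addgt0Pl => e e0; rewrite addr0.
have e20 : 0 < e / 2 by rewrite divr_gt0.
have [del1 del10 k1] := close _ c1 _ e20.
have [del2 del20 k2] := close _ c2 _ e20.
pose M := `|d| + `|d'| + 1.
have M0 : 0 < M by rewrite ltr_wpDl// addr_ge0.
pose h := Num.min del1 del2 / (2 * M).
have h0 : 0 < h by rewrite divr_gt0 ?mulr_gt0// lt_min del10.
have hM : h * (`|d| + `|d'|) < Num.min del1 del2.
  have : h * M = Num.min del1 del2 / 2 by rewrite /h invfM mulrA mulfVK// gt_eqF.
  have : 0 < Num.min del1 del2 by rewrite lt_min del10.
  by rewrite /M mulrDr mulr1; lra.
have small s t : `|s| <= `|h| -> `|t| <= `|h| -> `|s *: d + t *: d'| < Num.min del1 del2.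
  rewrite (gtr0_norm h0) => hs ht; apply: le_lt_trans hM.
  by rewrite (le_trans (ler_normD _ _))// !normrZ mulrDr lerD// ler_wpM2r.
have [s [t [hs ht est]]] := C1along_mvt2 z h h H1 H2.
have [t' [s' [ht' hs' est']]] := C1along_mvt2 z h h H3 H4.
have hh : h * h != 0 by rewrite mulf_neq0// gt_eqF.
have E12 : fdd' (z + s *: d + t *: d') = fd'd (z + t' *: d' + s' *: d).
  apply: (mulfI hh); rewrite -est -est'.
  by rewrite [z + h *: d' + _]addrAC; ring.
have l1 : `|z + s *: d + t *: d' - z| < del1.
  rewrite -(addrA z) [z + _]addrC addrK.
  by have := small _ _ hs ht; rewrite lt_min => /andP[].
have l2 : `|z + t' *: d' + s' *: d - z| < del2.
  rewrite -(addrA z) [z + _]addrC addrK addrC.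
  by have := small _ _ hs' ht'; rewrite lt_min => /andP[].
have {l1} := k1 _ l1; have {l2} := k2 _ l2; rewrite E12 => l2 l1.
set x := fd'd _ in l1 l2 *.
rewrite -(subrKA x) (le_trans (ler_normD _ _))// [e]splitr lerD// ltW//.
by rewrite distrC.
Qed.

End Calculus.

(** * Lattice averages and null functions *)

Section UniformContinuity.
Variables (R : realType) (E : normedModType R).

(** Only the base point has to lie in [K], because difference quotients at a lattice point may
    evaluate functions outside the box. *)
Lemma compact_unif_cont (K : set E) (g : E -> R) : compact K -> continuous g ->
  forall e : R, 0 < e -> exists2 del : R, 0 < del &
    forall z z', K z -> `|z' - z| < del -> `|g z' - g z| <= e.
Proof.
move=> /compact_near_coveringP cK cg e e0.
have H : \forall del \near (0 : R)^'+, K `<=` (fun z => forall z',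
    `|z' - z| < del -> `|g z' - g z| <= e).
  apply: cK => x _.
  have e20 : 0 < e / 2 by rewrite divr_gt0.
  have /cvgrPdist_lt /(_ _ e20) := cg x.
  move=> /nbhs_ballP[eta /= eta0 heta].
  have eta20 : 0 < eta / 2 by rewrite divr_gt0.
  exists (ball x (eta / 2), [set del | del < eta / 2]).
    split; first exact: nbhsx_ballx.
    exact: nbhs_right_lt.
  move=> [z del] /= [xz deleta] z' zz'.
  have h1 : ball x eta z by apply: le_ball xz; lra.
  have h2 : ball x eta z'.
    have zz'b : ball z (eta / 2) z'.
      by rewrite -ball_normE /= distrC; apply: lt_trans deleta.
    by rewrite [eta]splitr; exact: ball_triangle xz zz'b.
  have := heta _ h1; have := heta _ h2 => /= k1 k2.
  rewrite -(subrKA (g x)) (le_trans (ler_normD _ _))//.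
  by rewrite [e]splitr lerD// ltW// distrC.
have [del [del0 Hdel]] := filter_ex (filterI H (nbhs_right_gt 0)).
by exists del => // z z' Kz; exact: del0.
Qed.

End UniformContinuity.

Section Lattice.
Variables (R : realType) (E : normedModType R) (C : finType).
Variables (z0 : E) (D : C -> E) (K U : set E).

(** A grid of mesh 1/(n+1) on [-1, 1] that contains both endpoints. A cyclic rotation of the indices
    then wraps only from one endpoint to the other, where functions with support in the open box
    vanish. *)
Definition latcoord (n : nat) (i : 'I_(2 * n.+1).+1) : R := i%:R / n.+1%:R - 1.

Definition latpt (n : nat) (a : {ffun C -> 'I_(2 * n.+1).+1}) : E :=
  z0 + \sum_c latcoord (a c) *: D c.

Definition latavg (n : nat) (g : E -> R) : R :=
  (\sum_(a : {ffun C -> 'I_(2 * n.+1).+1}) g (latpt a)) /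
  #|{: {ffun C -> 'I_(2 * n.+1).+1}}|%:R.

Definition null_avg (g : E -> R) : Prop := latavg n g @[n --> \oo] --> (0 : R).

(** Uniform convergence on the lattices. The bound on the limit is what makes the notion stable
    under products. *)
Definition latucv (G : nat -> E -> R) (g : E -> R) : Prop :=
  (exists M : R, forall n (a : {ffun C -> 'I_(2 * n.+1).+1}), `|g (latpt a)| <= M) /\
  forall e : R, 0 < e -> \forall n \near \oo,
    forall a : {ffun C -> 'I_(2 * n.+1).+1}, `|G n (latpt a) - g (latpt a)| <= e.

Definition vanishes_off (g : E -> R) : Prop := forall z, ~ U z -> g z = 0.

Lemma card_lat_gt0 n : 0 < #|{: {ffun C -> 'I_(2 * n.+1).+1}}|%:R :> R.
Proof. by rewrite ltr0n; apply/card_gt0P; exists [ffun=> ord0]. Qed.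

Lemma latavgD n g1 g2 :
  latavg n (fun z => g1 z + g2 z) = latavg n g1 + latavg n g2.
Proof. by rewrite /latavg big_split mulrDl. Qed.

Lemma latavgZ n c g : latavg n (fun z => c * g z) = c * latavg n g.
Proof. by rewrite /latavg -big_distrr mulrA. Qed.

Lemma latavgB n g1 g2 :
  latavg n (fun z => g1 z - g2 z) = latavg n g1 - latavg n g2.
Proof. by rewrite /latavg sumrB mulrBl. Qed.

Lemma latavg_le n g1 g2 :
  (forall a : {ffun C -> 'I_(2 * n.+1).+1}, g1 (latpt a) <= g2 (latpt a)) ->
  latavg n g1 <= latavg n g2.
Proof.
move=> H; rewrite ler_pM2r ?invr_gt0 ?card_lat_gt0//.
by apply: ler_sum => a _.
Qed.

Lemma latavg_cst n c : latavg n (fun=> c) = c.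
Proof.
rewrite /latavg sumr_const -[X in X / _]mulr_natr mulfK//.
by rewrite gt_eqF// card_lat_gt0.
Qed.

Lemma latavg_norm_le n g e :
  (forall a : {ffun C -> 'I_(2 * n.+1).+1}, `|g (latpt a)| <= e) ->
  `|latavg n g| <= e.
Proof.
move=> H; rewrite ler_norml -(latavg_cst n e) -(latavg_cst n (- latavg n (fun=> e))).
by apply/andP; split; apply: latavg_le => a; have := H a; rewrite ?latavg_cst ler_norml => /andP[].
Qed.

Lemma null_avgD g1 g2 : null_avg g1 -> null_avg g2 ->
  null_avg (fun z => g1 z + g2 z).
Proof.
move=> h1 h2; rewrite /null_avg; under eq_cvg do rewrite latavgD.
have : latavg n g1 + latavg n g2 @[n --> \oo] --> (0 + 0 : R) by exact: cvgD.
by rewrite addr0.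
Qed.

Lemma null_avgZ c g : null_avg g -> null_avg (fun z => c * g z).
Proof.
move=> h; rewrite /null_avg; under eq_cvg do rewrite latavgZ.
have : c * latavg n g @[n --> \oo] --> (c * 0 : R) by exact: cvgMl_tmp.
by rewrite mulr0.
Qed.

Lemma null_avg_eq g1 g2 : null_avg g1 -> g1 =1 g2 -> null_avg g2.
Proof. by move=> + /funext <-. Qed.

(** The source of all basic null functions: two discretizations with exactly equal averages have
    limits whose difference is null. *)
Lemma latucv_null G1 g1 G2 g2 : latucv G1 g1 -> latucv G2 g2 ->
  (forall n, latavg n (G1 n) = latavg n (G2 n)) ->
  null_avg (fun z => g1 z - g2 z).
Proof.
move=> [_ h1] [_ h2] h12; apply/cvgr0Pnorm_le => e e0.
have e20 : 0 < e / 2 by rewrite divr_gt0.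
have := h1 _ e20; have := h2 _ e20; apply: filterS2 => n k2 k1.
have -> : latavg n (fun z => g1 z - g2 z) =
    latavg n (fun z => (g1 z - g2 z) - (G1 n z - G2 n z)).
  by rewrite [RHS]latavgB [X in _ - X]latavgB h12 subrr subr0.
apply: latavg_norm_le => a.
have -> : g1 (latpt a) - g2 (latpt a) - (G1 n (latpt a) - G2 n (latpt a)) =
  (G2 n (latpt a) - g2 (latpt a)) - (G1 n (latpt a) - g1 (latpt a)) by ring.
by rewrite (le_trans (ler_normB _ _))// [e]splitr lerD.
Qed.

Hypothesis HU : forall y : C -> R,
  U (z0 + \sum_c y c *: D c) -> forall c, `|y c| < 1.

Lemma vanishes_off_coord (g : E -> R) (y : C -> R) (c : C) : vanishes_off g ->
  1 <= `|y c| -> g (z0 + \sum_c y c *: D c) = 0.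
Proof. by move=> sg yc; apply: sg => /HU /(_ c); rewrite ltNge yc. Qed.

(** A translation by one mesh step permutes the lattice through [tau], except at the wrapped index,
    where both the translated value and the permuted one vanish. *)
Lemma latavg_shift n (g : E -> R) (c : C) (tau : 'I_(2 * n.+1).+1 -> 'I_(2 * n.+1).+1)
    (h : R) : vanishes_off g -> bijective tau ->
  (forall i, latcoord (tau i) = latcoord i + h \/
     1 <= `|latcoord (tau i)| /\ 1 <= `|latcoord i + h|) ->
  latavg n (fun z => g (z + h *: D c)) = latavg n g.
Proof.
move=> sg [tau' tauK tau'K] Htau; rewrite /latavg; congr (_ / _).
pose F t (a : {ffun C -> 'I_(2 * n.+1).+1}) : {ffun C -> 'I_(2 * n.+1).+1} :=
  [ffun c' => if c' == c then t (a c) else a c'].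
rewrite [RHS](reindex (F tau)) /=; last first.
  by exists (F tau') => a _; apply/ffunP => c'; rewrite !ffunE eqxx;
    case: eqP => [->|//]; rewrite ?tauK ?tau'K.
apply: eq_bigr => a _.
have -> : latpt a + h *: D c =
    z0 + \sum_c' (latcoord (a c') + (if c' == c then h else 0)) *: D c'.
  rewrite /latpt -addrA; congr (_ + _).
  under [RHS]eq_bigr do rewrite scalerDl.
  rewrite big_split /=; congr (_ + _).
  rewrite (bigD1 c) //= eqxx big1 ?addr0// => c' /negbTE ->.
  by rewrite scale0r.
have [e|[h1 h2]] := Htau (a c).
  congr (g (_ + _)); apply: eq_bigr => c' _; rewrite ffunE.
  by case: eqP => [->|_]; rewrite ?e ?addr0.
rewrite (@vanishes_off_coord _ _ c)//; last by rewrite eqxx.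
by rewrite /latpt (@vanishes_off_coord _ (fun c' => latcoord (F tau a c')) c)// ffunE eqxx.
Qed.

Lemma latavg_shiftS n (g : E -> R) (c : C) : vanishes_off g ->
  latavg n (fun z => g (z + n.+1%:R^-1 *: D c)) = latavg n g.
Proof.
move=> sg; apply: (@latavg_shift _ _ _ (@ordS _)) => //; first exact: ordS_bij.
move=> i; rewrite /latcoord /=.
have n0 : n.+1%:R != 0 :> R by rewrite pnatr_eq0.
have [ilt|ige] := ltnP i (2 * n.+1).
  by left; rewrite modn_small// -natr1; field.
right; have -> : i = (2 * n.+1)%N :> nat by apply/eqP; rewrite eqn_leq ige -ltnS ltn_ord.
rewrite modnn mul0r sub0r normrN1; split => //.
rewrite natrM mulfK// ger0_norm; first by rewrite -[2%:R]/(1+1 : R) addrK lerDl invr_ge0 ler0n.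
by rewrite -[2%:R]/(1+1 : R) addrK addr_ge0// invr_ge0 ler0n.
Qed.

Lemma latavg_shiftN n (g : E -> R) (c : C) : vanishes_off g ->
  latavg n (fun z => g (z + (- n.+1%:R^-1) *: D c)) = latavg n g.
Proof.
move=> sg; apply: (@latavg_shift _ _ _ (@ord_pred _)) => //; first exact: ord_pred_bij.
move=> i; rewrite /latcoord /=.
have n0 : n.+1%:R != 0 :> R by rewrite pnatr_eq0.
have [i0|ipos] := posnP i.
  right; rewrite i0 add0n /= modn_small// natrM mulfK// mul0r sub0r.
  rewrite -[2%:R]/(1+1 : R) addrK normr1; split => //.
  by rewrite -opprD normrN ger0_norm ?addr_ge0 ?lerDl ?invr_ge0 ?ler0n.
left; have -> : (i + (2 * n.+1).+1).-1 = (i.-1 + (2 * n.+1).+1)%N.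
  by rewrite -[in LHS](prednK ipos).
rewrite modnDr modn_small; last by rewrite (leq_ltn_trans (leq_pred _)).
by rewrite -[in RHS](prednK ipos) -[in RHS]natr1; field.
Qed.

Lemma latucvD G1 g1 G2 g2 : latucv G1 g1 -> latucv G2 g2 ->
  latucv (fun n z => G1 n z + G2 n z) (fun z => g1 z + g2 z).
Proof.
move=> [[M1 b1] h1] [[M2 b2] h2]; split.
  exists (M1 + M2) => n a; rewrite (le_trans (ler_normD _ _))// lerD//.
move=> e e0; have e20 : 0 < e / 2 by rewrite divr_gt0.
have := h1 _ e20; have := h2 _ e20; apply: filterS2 => n k2 k1 a.
rewrite opprD addrACA (le_trans (ler_normD _ _))// [e]splitr lerD//.
Qed.

Lemma latucvM G1 g1 G2 g2 : latucv G1 g1 -> latucv G2 g2 ->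
  latucv (fun n z => G1 n z * G2 n z) (fun z => g1 z * g2 z).
Proof.
move=> [[M1 b1] h1] [[M2 b2] h2]; split.
  by exists (M1 * M2) => n a; rewrite normrM ler_pM.
move=> e e0.
pose M := 1 + `|M1| + `|M2|.
have M0 : 0 < M by rewrite /M -addrA ltr_pwDl// addr_ge0.
pose e' := Num.min 1 (e / (2 * M)).
have e'0 : 0 < e' by rewrite lt_min ltr01 divr_gt0// mulr_gt0.
have := h1 _ e'0; have := h2 _ e'0; apply: filterS2 => n k2 k1 a.
move: (k1 a) (k2 a) (b1 n a) (b2 n a).
set x1 := G1 n _; set x2 := G2 n _; set y1 := g1 _; set y2 := g2 _ => l1 l2 m1 m2.
have -> : x1 * x2 - y1 * y2 = (x1 - y1) * x2 + y1 * (x2 - y2) by ring.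
have e'1 : e' <= 1 by rewrite ge_min lexx.
have nM1 := ler_norm M1; have nM2 := ler_norm M2.
have M1_0 := normr_ge0 M1; have M2_0 := normr_ge0 M2.
have x2M : `|x2| <= M.
  by have := ler_normD (x2 - y2) y2; rewrite subrK /M; lra.
have y1M : `|y1| <= M by rewrite /M; lra.
have e'M : e' * M <= e / 2.
  rewrite (@le_trans _ _ (e / (2 * M) * M))// ?ler_pM2r ?ge_min ?lexx ?orbT//.
  by rewrite invfM mulrA mulfVK// gt_eqF.
rewrite (le_trans (ler_normD _ _))// [e]splitr lerD// normrM.
  by rewrite (le_trans _ e'M)// ler_pM.
by rewrite (le_trans _ e'M)// mulrC ler_pM.
Qed.

Lemma latucvZ k G g : latucv G g -> latucv (fun n z => k * G n z) (fun z => k * g z).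
Proof.
move=> h; apply: (@latucvM (fun _ _ => k) (fun=> k)) h; split; first by exists `|k|.
by move=> e e0; near=> n => a; rewrite subrr normr0 ltW.
Unshelve. all: by end_near. Qed.

Hypothesis cK : compact K.
Hypothesis latK : forall n (a : {ffun C -> 'I_(2 * n.+1).+1}), K (latpt a).

(** By the mean value lemmas every difference quotient is a value of its limit at a point displaced
    by at most one mesh step in each direction, so uniform continuity suffices. *)
Lemma latucv_near (G : nat -> E -> R) (g : E -> R) (d d' : E) : continuous g ->
  (forall n z, exists s t : R, [/\ `|s| <= n.+1%:R^-1, `|t| <= n.+1%:R^-1 &
    G n z = g (z + s *: d + t *: d')]) ->
  latucv G g.
Proof.
move=> cg HG; split.
  have [M hM] : exists M : R, forall z, K z -> `|g z| <= M.
    have : bounded_set (g @` K).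
      by apply/compact_bounded/continuous_compact => //; exact: continuous_subspaceT.
    case=> M [_ /(_ (M + 1))]; rewrite ltrDl ltr01 => /(_ isT) HM.
    by exists (M + 1) => z Kz; apply: HM; exists z.
  by exists M => n a; exact: hM.
move=> e e0; have [del del0 Hdel] := compact_unif_cont cK cg e0.
have dd : 0 < del / (`|d| + `|d'| + 1).
  by rewrite divr_gt0// ltr_wpDl// addr_ge0.
have : \forall n \near \oo, (n.+1%:R^-1 : R) < del / (`|d| + `|d'| + 1).
  exact: near_infty_natSinv_lt (PosNum dd).
apply: filterS => n hn a.
have [s [t [sn tn ->]]] := HG n (latpt a).
apply: Hdel; first exact: latK.
rewrite -(addrA (latpt a)) [latpt a + _]addrC addrK (le_lt_trans (ler_normD _ _))// !normrZ.
rewrite ltr_pdivlMr in hn; last by rewrite ltr_wpDl// addr_ge0.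
apply: le_lt_trans hn; rewrite mulrDr mulrDr -[X in X <= _]addr0 !lerD ?ler_wpM2r// mulr1 invr_ge0 ler0n//.
Qed.

Lemma latucv_shift (g : E -> R) (d : E) (h : nat -> R) : continuous g ->
  (forall n, `|h n| <= n.+1%:R^-1) -> latucv (fun n z => g (z + h n *: d)) g.
Proof.
move=> cg hh; apply: (latucv_near (d := d) (d' := 0) cg) => n z.
by exists (h n), 0; split; rewrite ?normr0 ?invr_ge0 ?ler0n ?scale0r ?addr0 ?hh.
Qed.

Lemma latucv_diff (f f' : E -> R) (d : E) (h : nat -> R) : C1along d f f' ->
  (forall n, h n != 0) -> (forall n, `|h n| <= n.+1%:R^-1) ->
  latucv (fun n z => (h n)^-1 * (f (z + h n *: d) - f z)) f'.
Proof.
move=> cf h0 hh; have [_ cf' _] := cf.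
apply: (latucv_near (d := d) (d' := 0) cf') => n z.
have [t th ->] := C1along_mvt z (h n) cf.
exists t, 0; split; rewrite ?normr0 ?invr_ge0 ?ler0n ?scaler0 ?addr0 ?(le_trans th)//.
by rewrite mulKf.
Qed.

Lemma latucv_diff_shift (f f' : E -> R) (d d' : E) (h h' : nat -> R) : C1along d f f' ->
  (forall n, h n != 0) -> (forall n, `|h n| <= n.+1%:R^-1) ->
  (forall n, `|h' n| <= n.+1%:R^-1) ->
  latucv (fun n z => (h n)^-1 * (f (z + h' n *: d' + h n *: d) - f (z + h' n *: d'))) f'.
Proof.
move=> cf h0 hh hh'; have [_ cf' _] := cf.
apply: (latucv_near (d := d') (d' := d) cf') => n z.
have [t th ->] := C1along_mvt (z + h' n *: d') (h n) cf.
by exists (h' n), t; split => //; rewrite ?(le_trans th)// mulKf.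
Qed.

Lemma latucv_diff2 (f f' f'' : E -> R) (d d' : E) (h h' : nat -> R) :
  C1along d f f' -> C1along d' f' f'' ->
  (forall n, h n != 0) -> (forall n, `|h n| <= n.+1%:R^-1) ->
  (forall n, h' n != 0) -> (forall n, `|h' n| <= n.+1%:R^-1) ->
  latucv (fun n z => (h n * h' n)^-1 *
    (f (z + h n *: d + h' n *: d') - f (z + h n *: d) - f (z + h' n *: d') + f z)) f''.
Proof.
move=> cf cf' h0 hh h0' hh'; have [_ cf'' _] := cf'.
apply: (latucv_near (d := d) (d' := d') cf'') => n z.
have [s [t [sh th ->]]] := C1along_mvt2 z (h n) (h' n) cf cf'.
exists s, t; split; rewrite ?(le_trans sh) ?(le_trans th)//.
by rewrite mulKf// mulf_neq0.
Qed.

Lemma latucv0 : latucv (fun _ _ => 0) (fun=> 0).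
Proof.
split; first by exists 0 => n a; rewrite normr0.
by move=> e e0; near=> n => a; rewrite subrr normr0 ltW.
Unshelve. all: by end_near. Qed.

Let h n : R := n.+1%:R^-1.
Let h_neq0 n : h n != 0. Proof. by rewrite invr_eq0 pnatr_eq0. Qed.
Let hN_neq0 n : - h n != 0. Proof. by rewrite oppr_eq0. Qed.
Let h_le n : `|h n| <= n.+1%:R^-1.
Proof. by rewrite ger0_norm// invr_ge0 ler0n. Qed.
Let hN_le n : `|- h n| <= n.+1%:R^-1. Proof. by rewrite normrN. Qed.

Lemma vanishes_offMl (g w : E -> R) : vanishes_off g ->
  vanishes_off (fun z => g z * w z).
Proof. by move=> sg z /sg ->; rewrite mul0r. Qed.

Lemma null_div (c : C) (g g' : E -> R) : vanishes_off g -> C1along (D c) g g' ->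
  null_avg g'.
Proof.
move=> sg cg.
apply: null_avg_eq (latucv_null (latucv_diff cg h_neq0 h_le) latucv0 _) _; last first.
  by move=> z /=; rewrite subr0.
by move=> n; rewrite latavgZ latavgB latavg_shiftS// subrr mulr0 latavg_cst.
Qed.

(* Discrete integration by parts, applied twice, moves both differences to the
   other factor; no mixed second derivative of [g] or [w] is needed. *)
Lemma null_cross (c c' : C) (g gc gc' w wc wc' : E -> R) : vanishes_off g ->
  C1along (D c) g gc -> C1along (D c') g gc' ->
  C1along (D c) w wc -> C1along (D c') w wc' ->
  null_avg (fun z => gc z * wc' z - gc' z * wc z).
Proof.
move=> sg Hgc Hgc' Hwc Hwc'.
apply: latucv_null.
- exact: (latucvM (latucv_diff Hgc h_neq0 h_le) (latucv_diff Hwc' h_neq0 h_le)).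
- exact: (latucvM (latucv_diff Hgc' hN_neq0 hN_le) (latucv_diff Hwc hN_neq0 hN_le)).
move=> n /=.
pose P z := g z * (w (z - h n *: D c + h n *: D c') - w (z - h n *: D c)).
pose Q z := g z * (w (z + h n *: D c' - h n *: D c) - w (z + h n *: D c')).
have -> : (fun z => (h n)^-1 * (g (z + h n *: D c) - g z) *
    ((h n)^-1 * (w (z + h n *: D c') - w z))) = (fun z => ((h n)^-1 ^+ 2) *
    (P (z + h n *: D c) - g z * (w (z + h n *: D c') - w z))).
  by apply/funext => z; rewrite /P addrK; ring.
have -> : (fun z => (- h n)^-1 * (g (z + - h n *: D c') - g z) *
    ((- h n)^-1 * (w (z + - h n *: D c) - w z))) = (fun z => ((h n)^-1 ^+ 2) *
    (Q (z + (- h n) *: D c') - g z * (w (z - h n *: D c) - w z))).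
  by apply/funext => z; rewrite /Q !scaleNr subrK invrN; ring.
rewrite !latavgZ !latavgB latavg_shiftS; last exact: vanishes_offMl.
rewrite latavg_shiftN; last exact: vanishes_offMl.
rewrite -!latavgB; congr (_ * latavg _ _); apply/funext => z.
by rewrite /P /Q [z - _ + _]addrAC; ring.
Qed.

(* The central difference in time makes the discrete product rule for [w ^+ 2]
   exact, so no time derivative of [u'] is needed. *)
Lemma null_time (c t : C) (f f' ft u u' u'' ut : E -> R) : vanishes_off f ->
  C1along (D c) f f' -> C1along (D t) f ft ->
  C1along (D c) u u' -> C1along (D c) u' u'' -> C1along (D t) u ut ->
  null_avg (fun z => ut z * (f' z * u' z + f z * u'' z) -
                     2^-1 * (ft z * (u' z * u' z))).
Proof.
move=> sf Hf' Hft Hu' Hu'' Hut; have [cf _ _] := Hf'; have [cu' _ _] := Hu''.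
apply: null_avg_eq (latucv_null
  (latucvM (latucvZ 2^-1 (latucvD (latucv_diff Hut h_neq0 h_le) (latucv_diff Hut hN_neq0 hN_le)))
  (latucvD (latucvM (latucv_diff Hf' hN_neq0 hN_le) (latucv_diff Hu' h_neq0 h_le))
    (latucvM (latucv_shift (D c) cf hN_le) (latucv_diff2 Hu' Hu'' h_neq0 h_le hN_neq0 hN_le))))
  (latucvZ 2^-1 (latucvM (latucv_diff Hft h_neq0 h_le)
    (latucvM (latucv_diff Hu' h_neq0 h_le) (latucv_diff_shift (D t) Hu' h_neq0 h_le h_le)))) _) _; last first.
  by move=> z; field.
move=> n.
(* With [w] the forward quotient in space, both averages reduce after translation to that of - f w
   (w(z + h D_t) - w(z - h D_t)) / (2 h). *)
pose w z := (h n)^-1 * (u (z + h n *: D c) - u z).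
pose P z := f z * (w z * (u (z + h n *: D c + h n *: D t) - u (z + h n *: D c - h n *: D t))).
pose Q z := f z * (w z * w (z - h n *: D t)).
pose S z := f z * (w z * w (z + h n *: D t)).
pose T z := f z * (w z * (u (z + h n *: D t) - u (z - h n *: D t))).
transitivity (latavg n (fun z => ((2^-1) * (h n)^-1 ^+ 2) * (T z - P (z + (- h n) *: D c)))).
  congr latavg; apply/funext => z; rewrite /P /T /w !scaleNr !subrK addrK invrN invfM invrN.
  have := h_neq0 n; move: (h n) => k k0; field; exact: k0.
rewrite [in LHS]latavgZ [in LHS]latavgB latavg_shiftN; last exact: vanishes_offMl.
transitivity (latavg n (fun z => ((2^-1) * (h n)^-1) * (Q (z + h n *: D t) - S z))); last first.
  congr latavg; apply/funext => z; rewrite /S /Q /w addrK.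
  have := h_neq0 n; move: (h n) => k k0; field; exact: k0.
rewrite [in RHS]latavgZ [in RHS]latavgB latavg_shiftS; last exact: vanishes_offMl.
rewrite -!latavgB -!latavgZ; congr latavg; apply/funext => z.
rewrite /T /P /Q /S /w ![z + _ *: D t + _]addrAC ![z - _ *: D t + _]addrAC.
have := h_neq0 n; move: (h n) => k k0; field; exact: k0.
Qed.

End Lattice.

(** * Pointwise inequalities *)

Section RealInequalities.
Variable R : realType.

(** Young's inequality with a degenerate weight: the hypothesis [y ^+ 2 <= phi * c] replaces a
    division by [phi], which vanishes outside the box. The constant does not depend on [phi]. *)
Lemma young_weighted (a eta : R) : 0 < eta -> exists2 C : R, 0 <= C &
  forall phi c x y : R, 0 <= phi -> 0 <= c -> y ^+ 2 <= phi * c ->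
    a * x * y <= eta * (phi * x ^+ 2) + C * c.
Proof.
move=> eta0; exists (a ^+ 2 / (4 * eta)); first by rewrite divr_ge0 ?sqr_ge0// mulr_ge0// ltW.
move=> phi c x y; rewrite le_eqVlt => /predU1P[<- c0|phi0 c0].
  rewrite mul0r => y2; have /eqP : y ^+ 2 = 0 by apply/le_anti; rewrite y2 sqr_ge0.
  by rewrite sqrf_eq0 => /eqP ->; rewrite !mulr0 mul0r mulr0 add0r mulr_ge0// divr_ge0 ?sqr_ge0// mulr_ge0// ltW.
move=> y2.
have k : a ^+ 2 * y ^+ 2 <= a ^+ 2 * (phi * c) by rewrite ler_wpM2l// sqr_ge0.
have g0 : 0 < 4 * eta * phi by rewrite !mulr_gt0.
rewrite -subr_ge0 -(pmulr_rge0 _ g0).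
have -> : 4 * eta * phi * (eta * (phi * x ^+ 2) + a ^+ 2 / (4 * eta) * c - a * x * y)
  = (2 * eta * phi * x - a * y) ^+ 2 + (a ^+ 2 * (phi * c) - a ^+ 2 * y ^+ 2).
  by field; rewrite gt_eqF.
by rewrite addr_ge0 ?sqr_ge0// subr_ge0.
Qed.

Lemma sum_sqr_ge (n : nat) (x : 'I_n -> R) :
  (\sum_k x k) ^+ 2 <= n%:R * \sum_k x k ^+ 2.
Proof.
case: n x => [|n] x; first by rewrite !big_ord0 mulr0 expr0n.
have n0 : n.+1%:R != 0 :> R by rewrite pnatr_eq0.
have : 0 <= \sum_k (x k - (\sum_k x k) / n.+1%:R) ^+ 2.
  by apply: sumr_ge0 => k _; exact: sqr_ge0.
set X := \sum_k x k.
have -> : \sum_k (x k - X / n.+1%:R) ^+ 2 = \sum_k x k ^+ 2 - X ^+ 2 / n.+1%:R.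
  transitivity (\sum_k (x k ^+ 2 - 2 * (X / n.+1%:R) * x k + (X / n.+1%:R) ^+ 2)).
    by apply: eq_bigr => k _; ring.
  rewrite big_split sumrB /= -mulr_sumr -/X sumr_const card_ord -[X in _ + X]mulr_natr.
  by field.
by rewrite subr_ge0 ler_pdivrMr ?ltr0n// mulrC.
Qed.

Lemma trace_sqr_le (n : nat) (X : 'I_n -> 'I_n -> R) :
  (\sum_k X k k) ^+ 2 <= n%:R * \sum_k \sum_l X k l ^+ 2.
Proof.
apply: le_trans (sum_sqr_ge _) _; apply: ler_wpM2l; first exact: ler0n.
apply: ler_sum => k _; rewrite (bigD1 k)//= lerDl.
by apply: sumr_ge0 => l _; exact: sqr_ge0.
Qed.

(** The trace inequality for the matrix with entries H_kl - a g_k g_l, expanded; it is used with a =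
    b / v. *)
Lemma hessian_trace_ineq (n : nat) (H : 'I_n -> 'I_n -> R) (g : 'I_n -> R) (a : R) :
  (\sum_k H k k - a * \sum_k g k ^+ 2) ^+ 2 <=
  n%:R * (\sum_k \sum_l H k l ^+ 2 - 2 * a * (\sum_k \sum_l g k * g l * H k l)
          + a ^+ 2 * (\sum_k g k ^+ 2) ^+ 2).
Proof.
have := trace_sqr_le (fun k l => H k l - a * (g k * g l)).
rewrite sumrB -mulr_sumr.
under [X in _ - _ * X]eq_bigr do rewrite -expr2.
move=> /le_trans; apply; apply: ler_wpM2l; first exact: ler0n.
rewrite [(\sum_k g k ^+ 2) ^+ 2]expr2 big_distrlr /= !mulr_sumr -sumrB -big_split /=.
apply: ler_sum => k _; rewrite !mulr_sumr -sumrB -big_split /=.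
by apply: ler_sum => l _; rewrite le_eqVlt; apply/orP; left; apply/eqP; ring.
Qed.

(* Here and below, at a given point: [S = |grad v|^2], [s = S / v],
   [y = grad phi . grad v], [L] is the Laplacian of [v], [e] the error in the
   equation, and [P = psi^(k+2) / A^2], [Q = psi^k / A^4] for the cutoff
   [phi = psi^(k+4)] of a box of size [A]. *)
Lemma remainder_bound (alpha c1 b kappa lambda C1 : R) :
  0 < alpha -> 0 < lambda -> 0 <= kappa -> 0 <= C1 ->
  exists Aw C : R, [/\ 0 < Aw, 0 <= C &
  forall phi phit dphi P Q v S s y L f e vt : R,
    0 <= phi -> 0 <= P -> 0 <= Q -> 0 <= S -> 0 < v ->
    P ^+ 2 = phi * Q -> S = s * v -> L = vt - f - e ->
    y ^+ 2 <= C1 * phi * P * S -> `|phit| <= C1 * P -> `|dphi| <= C1 * P ->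
    kappa * (- vt * y + phit * S / 2 + y * f - phi * e * L)
    + c1 * phi * s * (vt - e) + L * y + b * y * s + dphi * S / 2
    + lambda * (y * f - phi * f * e) + Aw * (- vt * y + phit * S / 2 + phi * vt * e)
    <= alpha * (phi * s ^+ 2) + lambda / 2 * (phi * f ^+ 2) + Aw * (phi * vt ^+ 2)
       + C * (Q * v ^+ 2 + phi * e ^+ 2)].
Proof.
move=> al0 la0 ka0 C10.
(* Young applied to [c1 * phi * s * vt] with a quarter of [alpha] costs [c1 ^+ 2 / alpha] times
   [phi * vt ^+ 2]. [Aw] dominates this, and the [+ 1] leaves room for the other terms with [vt]. *)
pose Aw := 4 * c1 ^+ 2 / alpha + 1.
have AwE : Aw = 4 * c1 ^+ 2 / alpha + 1 by [].
have Aw0 : 0 < Aw by rewrite ltr_wpDl// divr_ge0 ?(ltW al0)// mulr_ge0 ?sqr_ge0.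
clearbody Aw.
have a8 : 0 < alpha / 8 by rewrite divr_gt0.
have l8 : 0 < lambda / 8 by rewrite divr_gt0.
have e8 : 0 < 8^-1 :> R by rewrite invr_gt0.
have [k1 k10 K1] := young_weighted (1 - kappa - Aw) e8.
have [k2 k20 K2] := young_weighted (kappa - 1 + lambda) l8.
have [k3 k30 K3] := young_weighted (-1) e8.
have [k4 k40 K4] := young_weighted b a8.
have [k5 k50 K5] := young_weighted (Aw - kappa) e8.
have [k6 k60 K6] := young_weighted (kappa - lambda) l8.
have [k7 k70 K7] := young_weighted (- c1) a8.
(* All terms of size [P * S] are collected here. As [P * S] is [s * (P * v)] and [(P * v) ^+ 2] is
   [phi * (Q * v ^+ 2)], one more Young inequality sends them into [phi * s ^+ 2] and
   [Q * v ^+ 2]. *)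
pose W := (k1 + k2 + k3 + k4) * C1 + (kappa + Aw + 1) / 2 * C1.
have W0 : 0 <= W.
  have Aw0' := ltW Aw0.
  by rewrite /W addr_ge0 ?mulr_ge0 ?invr_ge0 ?addr_ge0.
have [k8 k80 K8] := young_weighted W a8.
exists Aw, (k8 + (k5 + k6 + k7 + kappa + 1)); split => //; first by rewrite !addr_ge0.
move=> phi phit dphi P Q v S s y L f e vt p0 P0 Q0 S0 v0 PQ eS eL y2 ht hd.
have cc : 0 <= C1 * P * S by rewrite !mulr_ge0.
have y2' : y ^+ 2 <= phi * (C1 * P * S) by apply: le_trans y2 _; rewrite le_eqVlt; apply/orP; left; apply/eqP; ring.
have e2 : (phi * e) ^+ 2 <= phi * (phi * e ^+ 2) by rewrite le_eqVlt; apply/orP; left; apply/eqP; ring.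
have ce : 0 <= phi * e ^+ 2 by rewrite mulr_ge0// sqr_ge0.
have I1 := K1 phi _ vt y p0 cc y2'.
have I2 := K2 phi _ f y p0 cc y2'.
have I3 := K3 phi _ e y p0 cc y2'.
have I4 := K4 phi _ s y p0 cc y2'.
have I5 := K5 phi _ vt (phi * e) p0 ce e2.
have I6 := K6 phi _ f (phi * e) p0 ce e2.
have I7 := K7 phi _ s (phi * e) p0 ce e2.
have cQ : 0 <= Q * v ^+ 2 by rewrite mulr_ge0// sqr_ge0.
have q2 : (P * v) ^+ 2 <= phi * (Q * v ^+ 2) by rewrite exprMn PQ mulrA.
have I8 := K8 phi _ s (P * v) p0 cQ q2.
have J1 : phit * S <= C1 * P * S by rewrite ler_wpM2r// (le_trans (ler_norm _)).
have J2 : dphi * S <= C1 * P * S by rewrite ler_wpM2r// (le_trans (ler_norm _)).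
have J1' : (kappa + Aw) / 2 * (phit * S) <= (kappa + Aw) / 2 * (C1 * P * S).
  by rewrite ler_wpM2l// divr_ge0// addr_ge0// ltW.
have I9 : c1 * phi * s * vt <= alpha / 4 * (phi * s ^+ 2) + c1 ^+ 2 / alpha * (phi * vt ^+ 2).
  rewrite -subr_ge0.
  have -> : alpha / 4 * (phi * s ^+ 2) + c1 ^+ 2 / alpha * (phi * vt ^+ 2) - c1 * phi * s * vt
     = phi * alpha * (s / 2 - c1 / alpha * vt) ^+ 2 by field; rewrite gt_eqF.
  by rewrite mulr_ge0 ?sqr_ge0// mulr_ge0// ltW.
have hs : 0 <= phi * s ^+ 2 by rewrite mulr_ge0// sqr_ge0.
have hf : 0 <= phi * f ^+ 2 by rewrite mulr_ge0// sqr_ge0.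
have hvt : 0 <= phi * vt ^+ 2 by rewrite mulr_ge0// sqr_ge0.
have hal : 0 <= alpha * (phi * s ^+ 2) by rewrite mulr_ge0// ltW.
have hla : 0 <= lambda * (phi * f ^+ 2) by rewrite mulr_ge0// ltW.
have hc : 0 <= c1 ^+ 2 / alpha * (phi * vt ^+ 2) by rewrite mulr_ge0// divr_ge0 ?sqr_ge0// ltW.
have hAw : Aw * (phi * vt ^+ 2) = 4 * (c1 ^+ 2 / alpha * (phi * vt ^+ 2)) + phi * vt ^+ 2.
  by rewrite AwE; field; rewrite gt_eqF.
have hW : W * s * (P * v) = (k1 + k2 + k3 + k4) * (C1 * P * S) + (kappa + Aw + 1) / 2 * (C1 * P * S).
  by rewrite /W eS; ring.
have hk8 : 0 <= k8 * (phi * e ^+ 2) by rewrite mulr_ge0.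
have hk5 : 0 <= (k5 + k6 + k7 + kappa + 1) * (Q * v ^+ 2) by rewrite mulr_ge0// !addr_ge0.
have -> : kappa * (- vt * y + phit * S / 2 + y * f - phi * e * L)
    + c1 * phi * s * (vt - e) + L * y + b * y * s + dphi * S / 2
    + lambda * (y * f - phi * f * e) + Aw * (- vt * y + phit * S / 2 + phi * vt * e)
  = (1 - kappa - Aw) * vt * y + (kappa - 1 + lambda) * f * y + (-1) * e * y + b * s * y
    + (Aw - kappa) * vt * (phi * e) + (kappa - lambda) * f * (phi * e) + kappa * (phi * e ^+ 2)
    + (- c1) * s * (phi * e) + c1 * phi * s * vt
    + (kappa + Aw) / 2 * (phit * S) + (dphi * S) / 2.
  by rewrite eL; ring.
rewrite hAw; lra.
Qed.

(* The case [(v_j g_i - v_i g_j) ^+ 2 >= 0] of AM-GM, symmetrized with [B]. *)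
Lemma gradient_coupling (m n : nat) (B : 'M[R]_m) (r : R) (a v : 'I_m -> R)
    (g : 'I_m -> 'I_n -> R) : B^T = B -> (forall i j, 0 <= B i j) -> -1 <= r ->
  (forall i, 0 <= a i) -> (forall i, 0 < v i) ->
  \sum_i \sum_k (\sum_j B i j * (r * a i / v i * g i k * (a j * v j) +
     a i * (r * a j / v j * g j k * v j + a j * g j k))) * g i k <=
  (2 * r + 1) * \sum_i (\sum_j B i j * (a i * (a j * v j))) * ((\sum_k g i k ^+ 2) / v i).
Proof.
move=> Bsym B0 r0 a0 v0; rewrite -subr_ge0.
pose G i j k := B i j * (a i * a j) * (v j / v i * g i k ^+ 2 - g i k * g j k).
have BC i j : B i j = B j i by rewrite -[in LHS]Bsym mxE.
have -> : (2 * r + 1) * \sum_i (\sum_j B i j * (a i * (a j * v j))) * ((\sum_k g i k ^+ 2) / v i)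
  - \sum_i \sum_k (\sum_j B i j * (r * a i / v i * g i k * (a j * v j) +
     a i * (r * a j / v j * g j k * v j + a j * g j k))) * g i k
  = (r + 1) * \sum_i \sum_j \sum_k G i j k.
  rewrite !mulr_sumr -sumrB; apply: eq_bigr => i _.
  rewrite mulrCA !mulr_sumr mulr_suml mulr_suml.
  under [X in _ - X]eq_bigr do rewrite mulr_suml.
  rewrite exchange_big /= -sumrB; apply: eq_bigr => j _.
  rewrite !mulr_sumr -sumrB; apply: eq_bigr => k _.
  by rewrite /G; field; rewrite !gt_eqF.
have r1 : 0 <= r + 1 by rewrite -lerBlDr sub0r.
apply: mulr_ge0 => //.
suff : 0 <= 2 * \sum_i \sum_j \sum_k G i j k by rewrite pmulr_rge0.
have -> : 2 * \sum_i \sum_j \sum_k G i j k =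
    \sum_i \sum_j \sum_k (G i j k + G j i k).
  rewrite -[2]/(1 + 1 : R) mulrDl mul1r [X in _ + X = _]exchange_big /= -big_split /=.
  apply: eq_bigr => i _; rewrite -big_split /=; apply: eq_bigr => j _.
  by rewrite -big_split.
apply: sumr_ge0 => i _; apply: sumr_ge0 => j _; apply: sumr_ge0 => k _.
have vi := v0 i; have vj := v0 j.
have -> : G i j k + G j i k =
    B i j * (a i * a j) / (v i * v j) * (v j * g i k - v i * g j k) ^+ 2.
  by rewrite /G (BC j i); field; rewrite !gt_eqF.
apply: mulr_ge0; last exact: sqr_ge0.
by apply: divr_ge0; [rewrite !mulr_ge0|exact/ltW/mulr_gt0].
Qed.

(** The algebra of the integral estimate at one point, with [Z1], ..., [Z6] standing for functions
    that will be null. Summation over [i] is essential: the gradient structure (the bound on the sum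
    of [df]) and the potential ([Z5]) exist only for the whole system. *)
Lemma pointwise_estimate (m : nat) (alpha c1 b kappa p C1 CF cf : R) :
  0 < alpha -> 0 <= kappa -> 0 < p -> kappa * p < c1 -> 0 <= C1 -> 0 <= CF -> 0 < cf ->
  exists w3 w4 w5 c0 C : R, [/\ 0 < c0, 0 <= C &
  forall (phi phit dphi P Q F Z5 : R)
    (v S s y L f e vt df q Z1 Z2 Z3 Z4 Z6 : 'I_m -> R),
    0 <= phi -> 0 <= P -> 0 <= Q -> P ^+ 2 = phi * Q ->
    `|phit| <= C1 * P -> `|dphi| <= C1 * P ->
    (forall i, 0 <= S i) -> (forall i, 0 < v i) -> (forall i, S i = s i * v i) ->
    (forall i, L i = vt i - f i - e i) ->
    (forall i, y i ^+ 2 <= C1 * phi * P * S i) ->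
    (forall i, alpha * (phi * s i ^+ 2) <= kappa * (phi * L i ^+ 2)
      + c1 * (phi * s i * L i) + L i * y i + b * y i * s i + dphi * S i / 2
      - (Z1 i + Z6 i / 2 + b * Z2 i)) ->
    (forall i, Z3 i = y i * f i + phi * df i + phi * f i * L i) ->
    (forall i, Z4 i = vt i * y i + phi * vt i * L i - phit * S i / 2) ->
    Z5 = phit * F + phi * \sum_i f i * vt i ->
    \sum_i df i <= p * \sum_i f i * s i ->
    `|F| <= CF * \sum_i v i * q i ->
    (forall i, 0 <= q i) -> (forall i, cf * q i <= f i) ->
    c0 * (phi * \sum_i q i ^+ 2) <=
      \sum_i (w4 * Z4 i - w3 * Z3 i - Z1 i - Z6 i / 2 - b * Z2 i) + w5 * Z5
      + C * \sum_i (Q * v i ^+ 2 + phi * e i ^+ 2)].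
Proof.
move=> al0 ka0 p0 cp C10 CF0 cf0.
(* Chosen so that [c1 = (kappa + lambda) * p]: the good term [- c1 * phi * f * s] pays exactly for
   the gradient terms [df] arising from [kappa * phi * L ^+ 2] and from [lambda * phi * f ^+ 2]. *)
pose lambda := (c1 - kappa * p) / p.
have laE : lambda * p = c1 - kappa * p by rewrite /lambda mulfVK// gt_eqF.
have la0 : 0 < lambda by rewrite divr_gt0// subr_gt0.
clearbody lambda.
have [Aw [C [Aw0 C0 HC]]] := remainder_bound c1 b al0 la0 ka0 C10.
have eta0 : 0 < lambda * cf ^+ 2 / 4 by rewrite divr_gt0// mulr_gt0// exprn_gt0.
have [C' C'0 HC'] := young_weighted ((lambda + Aw) * C1 * CF) eta0.
(* The weights count uses: [phi * f * L] is eliminated with total weight [kappa + lambda],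
   [phi * vt * L] with [kappa + Aw], and [phi * f * vt] with [lambda + Aw]. Half of
   [lambda * cf ^+ 2 / 2] is kept as [c0]; the other half absorbs the term with [phit * F]. *)
exists (kappa + lambda), (kappa + Aw), (lambda + Aw), (lambda * cf ^+ 2 / 4), (C + C').
split => //; first by rewrite addr_ge0.
move=> phi phit dphi P Q F Z5 v S s y L f e vt df q Z1 Z2 Z3 Z4 Z6.
move=> ph0 P0 Q0 PQ hphit hdphi S0 v0 SE LE y2 h1 h3 h4 h5 hdf hF q0 hq.
have [Nl NlE] : exists Nl : 'I_m -> R, forall i, Nl i =
    (kappa + Aw) * Z4 i - (kappa + lambda) * Z3 i - Z1 i - Z6 i / 2 - b * Z2 i by eexists.
have PI i : lambda / 2 * (phi * f i ^+ 2) <= Nl i - c1 * phi * (f i * s i)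
    + (kappa + lambda) * phi * df i + (lambda + Aw) * phi * (f i * vt i)
    + C * (Q * v i ^+ 2 + phi * e i ^+ 2).
  have := HC phi phit dphi P Q (v i) (S i) (s i) (y i) (L i) (f i) (e i) (vt i)
    ph0 P0 Q0 (S0 i) (v0 i) PQ (SE i) (LE i) (y2 i) hphit hdphi.
  have := h1 i.
  have e1 : kappa * (phi * L i ^+ 2) = kappa * (phi * vt i * L i - phi * f i * L i - phi * e i * L i).
    by rewrite [in LHS]LE; move: (LE i) => ->; ring.
  have e2 : c1 * (phi * s i * L i) = c1 * phi * s i * (vt i - e i) - c1 * phi * (f i * s i).
    by rewrite LE; ring.
  have e3 : lambda * (phi * f i ^+ 2) = lambda * (phi * (f i * vt i) - phi * f i * L i - phi * f i * e i).
    by rewrite LE; ring.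
  have e4 : Aw * (phi * vt i ^+ 2) = Aw * (phi * vt i * L i + phi * (f i * vt i) + phi * vt i * e i).
    by rewrite LE; ring.
  have e5 : phi * vt i * L i = Z4 i - vt i * y i + phit * S i / 2 by rewrite h4; ring.
  have e6 : phi * f i * L i = Z3 i - y i * f i - phi * df i by rewrite h3; ring.
  rewrite e1 e2 NlE => k1 k2.
  rewrite e4 e5 in k2; rewrite e5 e6 in k1; rewrite e6 in e3.
  lra.
have PS : \sum_i lambda / 2 * (phi * f i ^+ 2) <= \sum_i (Nl i - c1 * phi * (f i * s i)
    + (kappa + lambda) * phi * df i + (lambda + Aw) * phi * (f i * vt i)
    + C * (Q * v i ^+ 2 + phi * e i ^+ 2)) by apply: ler_sum => i _.
rewrite !big_split /= !sumrN -!mulr_sumr !big_split /= -!mulr_sumr in PS.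
(* Here [q] stands for v^p, so [phit * F] is of size [P * v * q]; it splits into [phi * q ^+ 2] and
   [Q * v ^+ 2]. *)
have QI i : (lambda + Aw) * C1 * CF * P * (v i * q i) + lambda * cf ^+ 2 / 4 * (phi * q i ^+ 2)
    <= lambda / 2 * (phi * f i ^+ 2) + C' * (Q * v i ^+ 2).
  have cQ : 0 <= Q * v i ^+ 2 by rewrite mulr_ge0// sqr_ge0.
  have q2 : (P * v i) ^+ 2 <= phi * (Q * v i ^+ 2) by rewrite exprMn PQ mulrA.
  have := HC' phi _ (q i) (P * v i) ph0 cQ q2.
  have fq : lambda / 2 * (phi * (cf * q i) ^+ 2) <= lambda / 2 * (phi * f i ^+ 2).
    rewrite ler_wpM2l ?divr_ge0 ?(ltW la0)// ler_wpM2l// lerXn2r// ?nnegrE ?mulr_ge0 ?(ltW cf0)//.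
    by rewrite (le_trans _ (hq i))// mulr_ge0// ltW.
  move: fq; rewrite exprMn; lra.
have QS : \sum_i ((lambda + Aw) * C1 * CF * P * (v i * q i) + lambda * cf ^+ 2 / 4 * (phi * q i ^+ 2))
    <= \sum_i (lambda / 2 * (phi * f i ^+ 2) + C' * (Q * v i ^+ 2)) by apply: ler_sum => i _.
rewrite !big_split /= -!mulr_sumr in QS.
have FI : (lambda + Aw) * (- (phit * F)) <= (lambda + Aw) * C1 * CF * P * \sum_i v i * q i.
  rewrite -!mulrA; apply: ler_wpM2l; first by rewrite addr_ge0// ltW.
  rewrite (le_trans (ler_norm _))// normrN normrM.
  rewrite (@le_trans _ _ (C1 * P * (CF * \sum_i v i * q i)))//; first exact: ler_pM.
  by rewrite le_eqVlt; apply/orP; left; apply/eqP; ring.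
have DI : (kappa + lambda) * phi * \sum_i df i <= (kappa + lambda) * phi * (p * \sum_i f i * s i).
  by rewrite ler_wpM2l// mulr_ge0// addr_ge0// ltW.
have c1E : c1 = (kappa + lambda) * p by rewrite mulrDl laE; ring.
have DE : (kappa + lambda) * phi * (p * \sum_i f i * s i) = c1 * phi * \sum_i f i * s i.
  by rewrite c1E; ring.
rewrite DE in DI.
have ZE : (lambda + Aw) * phi * \sum_i f i * vt i = (lambda + Aw) * (Z5 + - (phit * F)).
  by rewrite h5; ring.
rewrite ZE in PS.
under [X in _ <= X + _ + _]eq_bigr do rewrite -NlE.
rewrite !big_split /= -!mulr_sumr.
have E0 : 0 <= C' * (phi * \sum_i e i ^+ 2).
  by rewrite !mulr_ge0// sumr_ge0// => i _; exact: sqr_ge0.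
lra.
Qed.

End RealInequalities.

(** * Null functions attached to a solution *)

Section Powers.
Variables (R : realType) (E : normedModType R).

Lemma C1alongV (d : E) (v v' : E -> R) : (forall z, 0 < v z) -> C1along d v v' ->
  C1along d (fun z => (v z)^-1) (fun z => - v' z / v z ^+ 2).
Proof.
move=> v0 cv.
have vn z : v z != 0 by rewrite gt_eqF.
have := @C1along_comp _ _ d v v' (fun x => x^-1) (fun x => - x ^- 2) cv.
have H1 z : is_derive (v z) 1 (fun x : R => x^-1) (- (v z) ^- 2).
  have := @is_deriveV R id (v z) 1 1 (vn z) (is_derive_id _ _).
  by rewrite /GRing.scale /= mulr1.
have H2 z : {for v z, continuous (fun x : R => - x ^- 2)}.
  apply: cvgN; apply: cvgV; first by rewrite expf_neq0.
  by apply: exprn_continuous.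
by move=> /(_ H1 H2); congr C1along; apply/funext => z; rewrite mulNr mulrC mulNr.
Qed.

(** Positivity is needed because for r < 1 the power is not differentiable at 0. Writing the
    derivative as [r * v]^ r / v[leaves only rational expressions in]v[and]v [^ r]. *)
Lemma C1along_powR (d : E) (v v' : E -> R) (r : R) : (forall z, 0 < v z) ->
  C1along d v v' ->
  C1along d (fun z => v z `^ r) (fun z => r * v z `^ r / v z * v' z).
Proof.
move=> v0 cv.
have := @C1along_comp _ _ d v v' (fun x => x `^ r) (fun x => r * x `^ (r - 1)) cv.
have H1 z : is_derive (v z) 1 (fun x : R => x `^ r) (r * v z `^ (r - 1)).
  exact: is_derive1_powR.
have H2 z : {for v z, continuous (fun x : R => r * x `^ (r - 1))}.
  apply: cvgM; first exact: cvg_cst.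
  exact: is_derive1_continuous (is_derive1_powR (r - 1) (v0 z)).
move=> /(_ H1 H2); congr C1along; apply/funext => z.
have -> : v z `^ (r - 1) = v z `^ r / v z.
  by rewrite powRB ?powRr1 ?(ltW (v0 z))// (gt_eqF (v0 z)) implybT.
by rewrite mulrA.
Qed.

End Powers.

Section Estimate.
Variables (R : realType) (E : normedModType R) (N : nat).
Variables (e : 'I_N -> E) (tau : E) (van null : (E -> R) -> Prop).

(* [null] abstracts "has vanishing integral" on functions of space-time, and
   [van] "has support in a fixed bounded open set". *)
Definition null_calculus : Prop :=
  [/\ [/\ forall g w, van g -> van (fun z => g z * w z),
       (forall g1 g2, null g1 -> null g2 -> null (fun z => g1 z + g2 z)) &
       (forall c g, null g -> null (fun z => c * g z))],
      (forall k g g', van g -> C1along (e k) g g' -> null g') /\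
      (forall g g', van g -> C1along tau g g' -> null g'),
      (forall k l g gk gl w wk wl, van g ->
         C1along (e k) g gk -> C1along (e l) g gl ->
         C1along (e k) w wk -> C1along (e l) w wl ->
         null (fun z => gk z * wl z - gl z * wk z)) &
      (forall k f f' ft u u' u'' ut, van f ->
         C1along (e k) f f' -> C1along tau f ft ->
         C1along (e k) u u' -> C1along (e k) u' u'' -> C1along tau u ut ->
         null (fun z => ut z * (f' z * u' z + f z * u'' z) -
                        2^-1 * (ft z * (u' z * u' z))))].

(** The first space derivatives must vanish off the support as well, because they serve as cutoffs
    themselves in [null_laplacian_cutoff]. *)
Definition cutoff_derivatives (phi phit : E -> R) (phik phikk : 'I_N -> E -> R) : Prop :=
  [/\ van phi, forall k, van (phik k), C1along tau phi phit &
      forall k, C1along (e k) phi (phik k) /\ C1along (e k) (phik k) (phikk k)].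

Definition C21_derivatives (v vt : E -> R) (vk : 'I_N -> E -> R)
    (vkl : 'I_N -> 'I_N -> E -> R) : Prop :=
  C1along tau v vt /\ forall k, C1along (e k) v (vk k) /\
    forall l, C1along (e l) (vk k) (vkl k l).

Hypothesis nc : null_calculus.

Lemma null_eq g1 g2 : null g1 -> g1 =1 g2 -> null g2.
Proof. by move=> + /funext <-. Qed.

Variables (phi phit : E -> R) (phik phikk : 'I_N -> E -> R).
Hypothesis cphi : cutoff_derivatives phi phit phik phikk.

Let nD : forall g1 g2, null g1 -> null g2 -> null (fun z => g1 z + g2 z).
Proof. by have [[]] := nc. Qed.
Let nZ : forall c g, null g -> null (fun z => c * g z).
Proof. by have [[]] := nc. Qed.
Let vanM : forall g w, van g -> van (fun z => g z * w z).
Proof. by have [[]] := nc. Qed.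

Lemma null0 : null (fun=> 0).
Proof.
have [_ [_ ndt] _ _] := nc; have [vphi _ ct _] := cphi.
by apply: null_eq (nZ 0 (ndt _ _ vphi ct)) _ => z; rewrite mul0r.
Qed.

Lemma null_sum (I : Type) (s : seq I) (g : I -> E -> R) :
  (forall i, null (g i)) -> null (fun z => \sum_(i <- s) g i z).
Proof.
move=> h; elim: s => [|i s IH].
  by apply: null_eq null0 _ => z; rewrite big_nil.
by apply: null_eq (nD (h i) IH) _ => z; rewrite big_cons.
Qed.

Section OneFunction.
Variables (v vt : E -> R) (vk : 'I_N -> E -> R) (vkl : 'I_N -> 'I_N -> E -> R).
Hypothesis cv : C21_derivatives v vt vk vkl.
Hypothesis v0 : forall z, 0 < v z.

Definition lap z := \sum_k vkl k k z.
Definition sqgrad z := \sum_k vk k z ^+ 2.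
Definition gradphi z := \sum_k phik k z * vk k z.

Let sym k l z : vkl k l z = vkl l k z.
Proof.
have [_ H] := cv; have [Hk Hkl] := H k; have [Hl Hlk] := H l.
exact: C1along_schwarz Hk (Hkl l) Hl (Hlk k).
Qed.

Definition hessgrad z := \sum_k \sum_l vk k z * vk l z * vkl k l z.
Definition hessphi z := \sum_k \sum_l phik l z * vk k z * vkl k l z.
Definition sqhess z := \sum_k \sum_l vkl k l z ^+ 2.
Definition lapphi z := \sum_k phikk k z.

(** Bochner's formula in integrated form, free of third derivatives: the sum over [k] and [l] of the
    cross identity for the pair phi v_k, v_l. *)
Lemma null_bochner : null (fun z => phi z * lap z ^+ 2 + lap z * gradphi z
  - phi z * sqhess z - hessphi z).
Proof.
have [_ _ ncr _] := nc; have [vphi _ _ ck] := cphi; have [_ H] := cv.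
apply: null_eq (null_sum (index_enum 'I_N) (fun k => null_sum (index_enum 'I_N) (fun l => ncr k l
  (fun z => phi z * vk k z) _ _ (vk l) _ _ (vanM _ vphi)
  (C1alongM (ck k).1 ((H k).2 k)) (C1alongM (ck l).1 ((H k).2 l)) ((H l).2 k) ((H l).2 l)))) _.
move=> z; rewrite /sqhess /hessphi /lap /gradphi expr2 !big_distrlr /=.
rewrite [X in _ + X - _ - _]exchange_big /=.
rewrite !mulr_sumr -big_split -!sumrB; apply: eq_bigr => k _.
rewrite !mulr_sumr -big_split -!sumrB; apply: eq_bigr => l _.
by rewrite (sym l k) /=; ring.
Qed.

Lemma C1along_sqgrad k : C1along (e k) sqgrad (fun z => \sum_l 2 * vk l z * vkl l k z).
Proof.
have [_ H] := cv.
have := C1along_sum (index_enum 'I_N) (fun l => C1alongM ((H l).2 k) ((H l).2 k)).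
by congr C1along; apply/funext => z; apply: eq_bigr => l _; ring.
Qed.

(** The divergence of phi v^-1 |grad v|^2 grad v, which eliminates the Hessian term [hessgrad]. *)
Lemma null_gradient_flux : null (fun z => gradphi z * (sqgrad z / v z)
  - phi z * (sqgrad z / v z) ^+ 2 + 2 * (phi z * hessgrad z / v z)
  + phi z * (sqgrad z / v z) * lap z).
Proof.
have [_ [ndk _] _ _] := nc; have [vphi _ _ ck] := cphi; have [_ H] := cv.
apply: null_eq (null_sum (index_enum 'I_N) (fun k => ndk k
  (fun z => phi z * ((v z)^-1 * (sqgrad z * vk k z))) _ (vanM _ vphi)
  (C1alongM (ck k).1 (C1alongM (C1alongV v0 (H k).1)
    (C1alongM (C1along_sqgrad k) ((H k).2 k)))))) _.
move=> z.
have vn : v z != 0 by rewrite gt_eqF.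
transitivity (\sum_k (phik k z * vk k z * (sqgrad z / v z)
  - vk k z ^+ 2 * (phi z * sqgrad z / v z ^+ 2)
  + (\sum_l vk k z * vk l z * vkl k l z) * (2 * phi z / v z)
  + vkl k k z * (phi z * (sqgrad z / v z)))).
  apply: eq_bigr => k _.
  have -> : \sum_l 2 * vk l z * vkl l k z = 2 * \sum_l vk l z * vkl l k z.
    by rewrite mulr_sumr; apply: eq_bigr => l _; rewrite mulrA.
  have -> : \sum_l vk k z * vk l z * vkl k l z = vk k z * \sum_l vk l z * vkl l k z.
    by rewrite mulr_sumr; apply: eq_bigr => l _; rewrite (sym k l) mulrA.
  by field.
rewrite !big_split /= sumrN -!mulr_suml -/(gradphi z) -/(sqgrad z) -/(lap z) -/(hessgrad z).
by field.
Qed.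

(** The divergence of |grad v|^2 grad phi, which trades [hessphi] for the Laplacian of the
    cutoff. *)
Lemma null_laplacian_cutoff : null (fun z => lapphi z * sqgrad z + 2 * hessphi z).
Proof.
have [_ [ndk _] _ _] := nc; have [_ vphik _ ck] := cphi; have [_ H] := cv.
apply: null_eq (null_sum (index_enum 'I_N) (fun k => ndk k
  (fun z => phik k z * sqgrad z) _ (vanM _ (vphik k))
  (C1alongM (ck k).2 (C1along_sqgrad k)))) _.
move=> z; rewrite big_split /= -mulr_suml; congr (_ + _).
rewrite /hessphi [in RHS]exchange_big /= mulr_sumr; apply: eq_bigr => k _.
by rewrite !mulr_sumr; apply: eq_bigr => l _; ring.
Qed.

Lemma null_source (f : E -> R) (fk : 'I_N -> E -> R) :
  (forall k, C1along (e k) f (fk k)) ->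
  null (fun z => gradphi z * f z + phi z * (\sum_k fk k z * vk k z) + phi z * f z * lap z).
Proof.
move=> Hf; have [_ [ndk _] _ _] := nc; have [vphi _ _ ck] := cphi; have [_ H] := cv.
apply: null_eq (null_sum (index_enum 'I_N) (fun k => ndk k
  (fun z => phi z * (f z * vk k z)) _ (vanM _ vphi)
  (C1alongM (ck k).1 (C1alongM (Hf k) ((H k).2 k))))) _.
move=> z; rewrite /gradphi /lap mulr_suml !mulr_sumr -!big_split /=.
by apply: eq_bigr => k _; ring.
Qed.

(** Formally the space divergence of phi v_t grad v minus the time derivative of phi |grad v|^2 / 2;
    the terms with grad v_t, which need not exist, would cancel. *)
Lemma null_time_derivative : null (fun z => vt z * gradphi z + phi z * vt z * lap z
  - phit z * sqgrad z / 2).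
Proof.
have [_ _ _ nt] := nc; have [vphi _ ct ck] := cphi; have [Ht H] := cv.
apply: null_eq (null_sum (index_enum 'I_N) (fun k => nt k _ _ _ _ _ _ _ vphi
  (ck k).1 ct (H k).1 ((H k).2 k) Ht)) _.
move=> z; rewrite /gradphi /lap /sqgrad !mulr_sumr mulr_suml -big_split -sumrB /=.
by apply: eq_bigr => k _; field.
Qed.

(** The trace inequality with a = b / v, multiplied by phi / N. The three null expressions eliminate
    [sqhess], [hessphi] and [hessgrad]; the coefficients are what remains of s^2, L^2 and s L. *)
Lemma gradient_inequality (b kappa s : R) z : (0 < N)%N -> 0 <= phi z ->
  kappa = (N%:R - 1) / N%:R -> s = sqgrad z / v z ->
  (b * (1 - b * kappa)) * (phi z * s ^+ 2) <= kappa * (phi z * lap z ^+ 2)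
      + (b * (N%:R + 2) / N%:R) * (phi z * s * lap z) + lap z * gradphi z
      + b * gradphi z * s + lapphi z * sqgrad z / 2
      - ((phi z * lap z ^+ 2 + lap z * gradphi z - phi z * sqhess z - hessphi z)
         + (lapphi z * sqgrad z + 2 * hessphi z) / 2
         + b * (gradphi z * s - phi z * s ^+ 2 + 2 * (phi z * hessgrad z / v z)
               + phi z * s * lap z)).
Proof.
move=> N0 ph0 -> ->.
have n0 : 0 < N%:R :> R by rewrite ltr0n.
have vn : v z != 0 by rewrite gt_eqF.
have := hessian_trace_ineq (fun k l => vkl k l z) (fun k => vk k z) (b / v z).
rewrite -/(lap z) -/(sqgrad z) -/(sqhess z) -/(hessgrad z) => H.
have {}H := ler_wpM2l ph0 H.
rewrite -subr_ge0 -(pmulr_rge0 _ n0).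
rewrite -subr_ge0 in H; apply: le_trans H _.
rewrite le_eqVlt; apply/orP; left; apply/eqP.
by field; rewrite vn gt_eqF.
Qed.

End OneFunction.

End Estimate.

(** * The system *)

Section System.
Variable R : realType.

Lemma cauchy_schwarz_sum (n : nat) (x y : 'I_n -> R) :
  (\sum_k x k * y k) ^+ 2 <= (\sum_k x k ^+ 2) * (\sum_k y k ^+ 2).
Proof.
rewrite -subr_ge0 -(@pmulr_rge0 _ 2)//.
have -> : 2 * ((\sum_k x k ^+ 2) * (\sum_k y k ^+ 2) - (\sum_k x k * y k) ^+ 2) =
    \sum_k \sum_l (x k * y l - x l * y k) ^+ 2.
  rewrite mulrBr -[2]/(1 + 1 : R) mulrDl mul1r.
  rewrite {2}[(\sum_k x k ^+ 2) * _]mulrC expr2 !big_distrlr /= -big_split /=.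
  rewrite mulr_sumr -sumrB; apply: eq_bigr => k _.
  rewrite -big_split /= mulr_sumr -sumrB; apply: eq_bigr => l _ /=.
  by ring.
by apply: sumr_ge0 => k _; apply: sumr_ge0 => l _; exact: sqr_ge0.
Qed.

(** For N > 1 the conditions read b < N/(N-1) and b > (N-1)p/(N+2); they are compatible exactly when
    p < N(N+2)/(N-1)^2. For N = 1 both are satisfied by every b > 0. *)
Lemma subcritical_weight (N : nat) (r : R) : (1 <= N)%N -> 0 < r ->
  ((2 * r + 1)%:E < pB R N)%E ->
  exists b : R, [/\ 0 < b, b * ((N%:R - 1) / N%:R) < 1 &
    (N%:R - 1) / N%:R * (2 * r + 1) < b * (N%:R + 2) / N%:R].
Proof.
rewrite /pB => N1 r0; case: eqP => [->|/eqP N1' hp].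
  by move=> _; exists 1; rewrite subrr !mul0r mulr0; split => //; lra.
have {hp} : 2 * r + 1 < N%:R * (N%:R + 2) / (N%:R - 1) ^+ 2 by rewrite -lte_fin.
have n1 : 1 < N%:R :> R by rewrite ltr1n ltn_neqAle eq_sym N1'.
move: (N%:R : R) n1 => n n1.
have n0 : 0 < n by lra.
have n10 : 0 < n - 1 by lra.
rewrite ltr_pdivlMr ?exprn_gt0// => hp.
pose b1 := (n - 1) * (2 * r + 1) / (n + 2).
pose b2 := n / (n - 1).
have n2 : 0 < n + 2 by lra.
have b12 : b1 < b2.
  rewrite /b1 /b2 ltr_pdivrMr// mulrAC ltr_pdivlMr//.
  by apply: le_lt_trans hp; rewrite le_eqVlt; apply/orP; left; apply/eqP; ring.
have b10 : 0 < b1 by rewrite divr_gt0// mulr_gt0//; lra.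
exists ((b1 + b2) / 2); split; first lra.
  rewrite mulrA ltr_pdivrMr// mul1r -ltr_pdivlMr// -/b2; lra.
rewrite mulrAC ltr_pM2r ?invr_gt0// -ltr_pdivrMr// -/b1; lra.
Qed.

Definition source (E : Type) (m : nat) (B : 'M[R]_m) (r : R) (v : 'I_m -> E -> R) i z :=
  \sum_j B i j * (v i z `^ r * (v j z `^ r * v j z)).

(** The factor undoes the exponent r + 1 of the product rule and the double count of each pair by
    the symmetric sum. *)
Definition potential (E : Type) (m : nat) (B : 'M[R]_m) (r : R) (v : 'I_m -> E -> R) z :=
  (2 * (r + 1))^-1 *
  \sum_i \sum_j B i j * ((v i z `^ r * v i z) * (v j z `^ r * v j z)).

Lemma potential_bound (m : nat) (B : 'M[R]_m) (x : 'I_m -> R) :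
  (forall i j, 0 <= B i j) -> (forall i, 0 <= x i) ->
  `|\sum_i \sum_j B i j * (x i * x j)| <= (\sum_i \sum_j B i j) * \sum_i x i ^+ 2.
Proof.
move=> B0 x0; rewrite ger0_norm; last first.
  by apply: sumr_ge0 => i _; apply: sumr_ge0 => j _; rewrite !mulr_ge0.
have xX i : x i ^+ 2 <= \sum_k x k ^+ 2.
  by rewrite (bigD1 i)//= lerDl sumr_ge0// => k _; exact: sqr_ge0.
rewrite mulr_suml; apply: ler_sum => i _; rewrite mulr_suml; apply: ler_sum => j _.
apply: ler_wpM2l => //; have := xX i; have := xX j; have := sqr_ge0 (x i - x j).
rewrite sqrrB; lra.
Qed.

Lemma min_diag (m : nat) (B : 'M[R]_m) : (forall i, 0 < B i i) ->
  exists2 c : R, 0 < c & forall i, c <= B i i.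
Proof.
move=> B0; exists (\big[Num.min/1]_i B i i); first by apply: lt_bigmin.
by move=> i; exact: bigmin_le_cond.
Qed.

Section WithData.
Variables (E : normedModType R) (N m : nat) (e : 'I_N -> E) (tau : E).
Variables (r : R) (B : 'M[R]_m).
Variables (v vt : 'I_m -> E -> R) (vk : 'I_m -> 'I_N -> E -> R).
Hypothesis v0 : forall i z, 0 < v i z.

Definition grad_source i k z := \sum_j B i j *
  (r * v i z `^ r / v i z * vk i k z * (v j z `^ r * v j z) +
   v i z `^ r * (r * v j z `^ r / v j z * vk j k z * v j z + v j z `^ r * vk j k z)).

Lemma C1along_source i k : (forall j, C1along (e k) (v j) (vk j k)) ->
  C1along (e k) (source B r v i) (grad_source i k).
Proof.
move=> Hv; apply: C1along_sum => j; apply: C1alongZ.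
by apply: C1alongM; [exact: C1along_powR|apply: C1alongM => //; exact: C1along_powR].
Qed.

Lemma C1along_potential : B^T = B -> 0 < r -> (forall j, C1along tau (v j) (vt j)) ->
  C1along tau (potential B r v) (fun z => \sum_i source B r v i z * vt i z).
Proof.
move=> Bsym r0 Hv.
have BC i j : B i j = B j i by rewrite -[in LHS]Bsym mxE.
have Hw j := C1alongM (C1along_powR r (v0 j) (Hv j)) (Hv j).
have := C1alongZ (2 * (r + 1))^-1 (C1along_sum (index_enum 'I_m) (fun i =>
  C1along_sum (index_enum 'I_m) (fun j => C1alongZ (B i j) (C1alongM (Hw i) (Hw j))))).
congr C1along; apply/funext => z.
have r1 : r + 1 != 0 by rewrite gt_eqF// addr_gt0.
pose G i j := B i j * (v i z `^ r * (v j z `^ r * v j z)) * vt i z.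
transitivity (2^-1 * \sum_i \sum_j (G i j + G j i)).
  rewrite !mulr_sumr; apply: eq_bigr => i _; rewrite !mulr_sumr; apply: eq_bigr => j _.
  by rewrite /G (BC j i); field; rewrite r1 !gt_eqF.
have -> : \sum_i \sum_j (G i j + G j i) = 2 * \sum_i \sum_j G i j.
  transitivity (\sum_i \sum_j G i j + \sum_i \sum_j G j i).
    by rewrite -big_split; apply: eq_bigr => i _; rewrite -big_split.
  by rewrite [X in _ + X = _]exchange_big /= -[2]/(1 + 1 : R) mulrDl mul1r.
rewrite mulrA mulVf ?mul1r ?pnatr_eq0//; apply: eq_bigr => i _.
by rewrite /source mulr_suml.
Qed.

End WithData.

(** [c0] and [C] are fixed before the space, the cutoff and [v], so they depend neither on the box
    size nor on the shift delta. The residual of the equation stays on the right as an error. *)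
Lemma system_estimate (N m : nat) (r b C1 : R) (B : 'M[R]_m) :
  (0 < N)%N -> 0 < r -> 0 < b -> b * ((N%:R - 1) / N%:R) < 1 ->
  (N%:R - 1) / N%:R * (2 * r + 1) < b * (N%:R + 2) / N%:R -> 0 <= C1 ->
  B^T = B -> (forall i j, 0 <= B i j) -> (forall i, 0 < B i i) ->
  exists c0 C : R, [/\ 0 < c0, 0 <= C &
  forall (E : normedModType R) (e : 'I_N -> E) (tau : E) (van null : (E -> R) -> Prop)
    (phi phit : E -> R) (phik phikk : 'I_N -> E -> R) (P Q : E -> R)
    (v vt : 'I_m -> E -> R) (vk : 'I_m -> 'I_N -> E -> R)
    (vkl : 'I_m -> 'I_N -> 'I_N -> E -> R),
    null_calculus e tau van null -> cutoff_derivatives e tau van phi phit phik phikk ->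
    (forall z, [/\ 0 <= phi z, 0 <= P z, 0 <= Q z & P z ^+ 2 = phi z * Q z]) ->
    (forall z, [/\ `|phit z| <= C1 * P z, `|\sum_k phikk k z| <= C1 * P z &
       \sum_k phik k z ^+ 2 <= C1 * phi z * P z]) ->
    (forall i, C21_derivatives e tau (v i) (vt i) (vk i) (vkl i)) ->
    (forall i z, 0 < v i z) ->
    exists2 Z : E -> R, null Z &
    forall z, c0 * (phi z * \sum_i (v i z `^ r * (v i z `^ r * v i z)) ^+ 2) <=
      Z z + C * \sum_i (Q z * v i z ^+ 2 +
        phi z * (vt i z - lap (vkl i) z - source B r v i z) ^+ 2)].
Proof.
move=> N0 r0 b0 bk kp C10 Bsym B0 Bd.
pose kappa : R := (N%:R - 1) / N%:R.
have ka0 : 0 <= kappa by rewrite divr_ge0// subr_ge0 ler1n.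
have al0 : 0 < b * (1 - b * kappa) by rewrite mulr_gt0// subr_gt0.
have p0 : 0 < 2 * r + 1 by rewrite addr_gt0// mulr_gt0.
have [cf cf0 hcf] := min_diag Bd.
have CF0 : 0 <= (2 * (r + 1))^-1 * \sum_i \sum_j B i j.
  apply: mulr_ge0; first by rewrite invr_ge0 mulr_ge0// addr_ge0// ltW.
  by apply: sumr_ge0 => i _; apply: sumr_ge0 => j _.
have [w3 [w4 [w5 [c0 [C [c00 C0 H]]]]]] :=
  pointwise_estimate m b al0 ka0 p0 kp C10 CF0 cf0.
exists c0, C; split => // E e tau van null phi phit phik phikk P Q v vt vk vkl.
move=> nc cphi hP hphi Hv v0.
have [[vanM nD nZ] [ndk ndt] _ _] := nc; have [vphi _ ct _] := cphi.
have Hk j k : C1along (e k) (v j) (vk j k) by have [_ /(_ k) []] := Hv j.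
pose f i := source B r v i.
pose Z1 i := (fun z => phi z * lap (vkl i) z ^+ 2 + lap (vkl i) z * gradphi phik (vk i) z
  - phi z * sqhess (vkl i) z - hessphi phik (vk i) (vkl i) z).
pose s i z := sqgrad (vk i) z / v i z.
pose Z2 i := (fun z => gradphi phik (vk i) z * s i z
  - phi z * s i z ^+ 2 + 2 * (phi z * hessgrad (vk i) (vkl i) z / v i z)
  + phi z * s i z * lap (vkl i) z).
pose df i z := \sum_k grad_source r B v vk i k z * vk i k z.
pose Z3 i := (fun z => gradphi phik (vk i) z * f i z + phi z * df i z + phi z * f i z * lap (vkl i) z).
pose Z4 i := (fun z => vt i z * gradphi phik (vk i) z + phi z * vt i z * lap (vkl i) z
  - phit z * sqgrad (vk i) z / 2).
pose Z6 i := (fun z => lapphi phikk z * sqgrad (vk i) z + 2 * hessphi phik (vk i) (vkl i) z).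
pose Z5 z := phit z * potential B r v z + phi z * \sum_i f i z * vt i z.
exists (fun z => \sum_i (w4 * Z4 i z - w3 * Z3 i z - Z1 i z - Z6 i z / 2 - b * Z2 i z) + w5 * Z5 z).
  apply: (nD); last first.
    apply: (nZ); apply: ndt (vanM _ _ vphi) (C1alongM ct _).
    by apply: C1along_potential => // j; have [] := Hv j.
  apply: (null_sum nc cphi) => i.
  have n1 : null (Z1 i) by exact (null_bochner nc cphi (Hv i)).
  have n2 : null (Z2 i) by exact (null_gradient_flux nc cphi (Hv i) (v0 i)).
  have n3 : null (Z3 i).
    exact (null_source nc cphi (Hv i) (fun k => C1along_source r B v0 i (fun j => Hk j k))).
  have n4 : null (Z4 i) by exact (null_time_derivative nc cphi (Hv i)).
  have n6 : null (Z6 i) by exact (null_laplacian_cutoff nc cphi (Hv i)).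
  apply: null_eq (nD _ _ (nD _ _ (nD _ _ (nD _ _ (nZ w4 _ n4) (nZ (- w3) _ n3))
    (nZ (-1) _ n1)) (nZ (- 2^-1) _ n6)) (nZ (- b) _ n2)) _ => z.
  by field.
move=> z.
have [h1 h2 h3 h4] := hP z; have [k1 k2 k3] := hphi z.
have S0 i : 0 <= sqgrad (vk i) z by apply: sumr_ge0 => k _; exact: sqr_ge0.
have a0 i : 0 <= v i z `^ r by exact: powR_ge0.
apply: (H (phi z) (phit z) (lapphi phikk z) (P z) (Q z) (potential B r v z) (Z5 z)
  (fun i => v i z) (fun i => sqgrad (vk i) z) (fun i => s i z)
  (fun i => gradphi phik (vk i) z) (fun i => lap (vkl i) z) (fun i => f i z)
  (fun i => vt i z - lap (vkl i) z - f i z) (fun i => vt i z)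
  (fun i => df i z) (fun i => v i z `^ r * (v i z `^ r * v i z))
  (fun i => Z1 i z) (fun i => Z2 i z) (fun i => Z3 i z) (fun i => Z4 i z) (fun i => Z6 i z)) => //.
- by move=> i; rewrite /s mulfVK// gt_eqF.
- by move=> i; ring.
- move=> i; apply: le_trans (cauchy_schwarz_sum _ _) _.
  by apply: ler_wpM2r; [exact: S0|exact: k3].
- by move=> i; apply: gradient_inequality.
- have := gradient_coupling (fun i k => vk i k z) Bsym B0 _ a0 (fun i => v0 i z).
  by apply; rewrite (le_trans _ (ltW r0))// lerN10.
- rewrite /potential normrM ger0_norm ?invr_ge0; last by rewrite mulr_ge0// addr_ge0// ltW.
  rewrite -mulrA; apply: ler_wpM2l; first by rewrite invr_ge0 mulr_ge0// addr_ge0// ltW.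
  have := potential_bound B0 (x := fun i => v i z `^ r * v i z) (fun i => mulr_ge0 (a0 i) (ltW (v0 i z))).
  move=> /le_trans; apply; rewrite le_eqVlt; apply/orP; left; apply/eqP; congr (_ * _).
  by apply: eq_bigr => i _; ring.
- by move=> i; rewrite !mulr_ge0// ltW.
- move=> i; have vi := ltW (v0 i z).
  rewrite /f /source (bigD1 i)//= -[X in X <= _]addr0 lerD//.
    by rewrite ler_wpM2r// !mulr_ge0.
  by apply: sumr_ge0 => j _; rewrite !mulr_ge0// ltW.
Qed.

End System.

(** * Cutoff functions *)

Section Cutoff.
Variable R : realType.

Definition pospow (n : nat) (s : R) : R := Num.max 0 s ^+ n.

Lemma pospow_continuous n : continuous (pospow n).
Proof.
move=> s; apply: (@continuous_comp _ _ _ (fun s : R => Num.max 0 s) (fun s => s ^+ n)).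
  by apply: continuous_max; [exact: cvg_cst|exact: cvg_id].
exact: exprn_continuous.
Qed.

Lemma pospow_ge0 n s : 0 <= pospow n s.
Proof. by rewrite exprn_ge0// le_max lexx. Qed.

Lemma is_derive_pospow n (s : R) :
  is_derive s 1 (pospow n.+2) (n.+2%:R * pospow n.+1 s).
Proof.
have [s0|s0|<-] := ltgtP 0 s.
- have H : is_derive s 1 (fun x : R => x ^+ n.+2) (n.+2%:R * pospow n.+1 s).
    rewrite /pospow (max_idPr (ltW s0)).
    have := @is_deriveX R R id n.+2 s 1 1 (is_derive_id _ _).
    by rewrite fctE /GRing.scale /= mulr1.
  apply: (@near_eq_is_derive _ _ _ _ _ _ _ _ _ H).
  have := lt_nbhsr s0; apply: filterS => x x0.
  by rewrite /pospow (max_idPr (ltW x0)).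
- have H : is_derive s 1 (fun=> 0 : R) (n.+2%:R * pospow n.+1 s).
    rewrite /pospow (max_idPl (ltW s0)) expr0n mulr0; exact: is_derive_cst.
  apply: (@near_eq_is_derive _ _ _ _ _ _ _ _ _ H).
  have := lt_nbhsl s0; apply: filterS => x x0.
  by rewrite /pospow (max_idPl (ltW x0)) expr0n.
(* At the corner the slope of [pospow n.+2] is exactly [pospow n.+1], on both sides. *)
- apply/is_derive1_caratheodory; exists (pospow n.+1); split.
  + move=> z; rewrite /pospow maxxx expr0n !subr0 [LHS]exprSr.
    by have [z0|z0] := leP 0 z; rewrite // exprS !mul0r.
  + exact: pospow_continuous.
  + by rewrite /pospow maxxx expr0n mulr0.
Qed.

Lemma C1along_pospow (E : normedModType R) (d : E) n (f f' : E -> R) : C1along d f f' ->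
  C1along d (fun z => pospow n.+2 (f z)) (fun z => n.+2%:R * pospow n.+1 (f z) * f' z).
Proof.
move=> Hf; apply: (C1along_comp (h := pospow n.+2) (h' := fun s => n.+2%:R * pospow n.+1 s) Hf).
  by move=> z; exact: is_derive_pospow.
by move=> z; apply: cvgM; [exact: cvg_cst|exact: pospow_continuous].
Qed.

(** The quotient of the first term on the right by the left side is eta (psi A v^r)^4. If it is at
    least 1, that term suffices. Otherwise psi A v^r is bounded, and its power 2/r bounds psi^(2/r)
    v^2 by a multiple of A^(-2/r); psi <= 1 and k >= 2/r do the rest. *)
Lemma powR_young (r eta : R) : 0 < r -> 0 < eta -> exists2 C : R, 0 <= C &
  forall (k : nat) (psi A v : R), 2 / r <= k%:R -> 0 <= psi <= 1 -> 0 < A -> 0 < v ->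
    psi ^+ k / A ^+ 4 * v ^+ 2 <=
      eta * (psi ^+ (k + 4) * (v `^ r * (v `^ r * v)) ^+ 2) + C * A `^ (- (4 + 2 / r)).
Proof.
move=> r0 eta0; exists (eta^-1 `^ (2 * r)^-1); first exact: powR_ge0.
move=> k psi A v hk /andP[psi0 psi1] A0 v0.
have w0 : 0 < v `^ r by exact: powR_gt0.
have A4 : 0 < A ^+ 4 by exact: exprn_gt0.
have T0 : 0 <= eta^-1 `^ (2 * r)^-1 * A `^ (- (4 + 2 / r)) by rewrite mulr_ge0 ?powR_ge0.
have [le1|gt1] := leP 1 (eta * (psi * A * v `^ r) ^+ 4).
  apply: ler_wpDr => //.
  have -> : eta * (psi ^+ (k + 4) * (v `^ r * (v `^ r * v)) ^+ 2) =
      psi ^+ k / A ^+ 4 * v ^+ 2 * (eta * (psi * A * v `^ r) ^+ 4).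
    by rewrite exprD; field; rewrite gt_eqF.
  by rewrite ler_peMr// mulr_ge0 ?sqr_ge0// divr_ge0 ?exprn_ge0// ltW.
apply: ler_wpDl; first by rewrite mulr_ge0 ?(ltW eta0)// mulr_ge0 ?sqr_ge0// exprn_ge0.
move: psi0; rewrite le_eqVlt => /predU1P[psi0|psi0].
  (* At psi = 0 the left side vanishes only for a positive exponent, since [0 ^+ 0] is 1. *)
  have k0 : (0 < k)%N.
    rewrite lt0n; apply/eqP => k0; move: hk; rewrite k0 leNgt.
    by rewrite divr_gt0.
  by rewrite -psi0 expr0n eqn0Ngt k0 !mul0r.
pose y := psi * A * v `^ r.
have y0 : 0 < y by rewrite !mulr_gt0.
have y4 : y ^+ 4 <= eta^-1 by rewrite -[leRHS]mul1r ler_pdivlMr// mulrC ltW.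
have r2 : 0 <= (2 * r)^-1 by rewrite invr_ge0 mulr_ge0// ltW.
have Hy : y `^ (2 / r) <= eta^-1 `^ (2 * r)^-1.
  have -> : y `^ (2 / r) = (y ^+ 4) `^ (2 * r)^-1.
    rewrite -powR_mulrn ?(ltW y0)// -powRrM; congr (_ `^ _).
    by field; rewrite gt_eqF.
  by apply: ge0_ler_powR => //; rewrite nnegrE ?invr_ge0; [exact/exprn_ge0/ltW|exact: ltW].
have yE : y `^ (2 / r) = psi `^ (2 / r) * A `^ (2 / r) * v ^+ 2.
  rewrite /y !powRM ?mulr_ge0 ?(ltW psi0) ?(ltW A0) ?(ltW w0)//.
  congr (_ * _); rewrite -powRrM mulrCA mulfV ?gt_eqF// mulr1.
  by rewrite powR_mulrn// ltW.
have psik : psi ^+ k <= psi `^ (2 / r).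
  by rewrite -powR_mulrn ?(ltW psi0)//; apply: ger_powR; rewrite ?psi0.
have AE : A `^ (- (4 + 2 / r)) = (A ^+ 4)^-1 / A `^ (2 / r).
  rewrite powRN powRD; last by rewrite (gt_eqF A0) implybT.
  by rewrite powR_mulrn ?(ltW A0)// invfM.
have Ar : 0 < A `^ (2 / r) by exact: powR_gt0.
apply: (@le_trans _ _ (psi `^ (2 / r) / A ^+ 4 * v ^+ 2)).
  by rewrite ler_wpM2r ?sqr_ge0// ler_wpM2r// invr_ge0 ltW.
rewrite AE; apply: (@le_trans _ _ (y `^ (2 / r) * ((A ^+ 4)^-1 / A `^ (2 / r)))).
  by rewrite yE le_eqVlt; apply/orP; left; apply/eqP; field; rewrite !gt_eqF.
by rewrite ler_wpM2r// divr_ge0 ?invr_ge0 ?(ltW A4) ?(ltW Ar).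
Qed.

End Cutoff.

(** * Lower bounds for lattice averages, and null functions under rescaled directions *)

Section LatticeBounds.
Variable R : realType.

(** Index [n.+1] is the coordinate 0. With [c] the integer part of theta (n+1), the [c.+1] indices
    starting there are already enough. *)
Lemma latcoord_count (n : nat) (theta : R) : 0 <= theta <= 1 ->
  theta * n.+1%:R <=
  \sum_(i : 'I_(2 * n.+1).+1) (`|latcoord R i| <= theta)%R%:R.
Proof.
move=> /andP[t0 t1].
have tn0 : 0 <= theta * n.+1%:R by rewrite mulr_ge0.
pose c := Num.truncn (theta * n.+1%:R).
have /andP[c1 c2] : c%:R <= theta * n.+1%:R < c.+1%:R by exact: truncn_itv.
have n0 : 0 < n.+1%:R :> R by rewrite ltr0n.
have cn : (c <= n.+1)%N.
  by rewrite -(ler_nat R) (le_trans c1)// ler_piMl// ltW.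
pose F (i : nat) : R := (`|i%:R / n.+1%:R - 1| <= theta)%R%:R.
have -> : \sum_(i : 'I_(2 * n.+1).+1) (`|latcoord R i| <= theta)%R%:R =
    \sum_(0 <= i < (2 * n.+1).+1) F i by rewrite big_mkord.
have F0 i : 0 <= F i by exact: ler0n.
rewrite (@big_cat_nat _ _ _ n.+1)//=; last by rewrite mul2n -addnn ltnW// ltnS leq_addr.
rewrite (@big_cat_nat _ _ _ (n.+1 + c.+1)%N n.+1)//=; last 2 first.
- by rewrite leq_addr.
- by rewrite mul2n -addnn -addnS leq_add2l ltnS.
have -> : \sum_(n.+1 <= i < n.+1 + c.+1) F i = c.+1%:R.
  rewrite (eq_big_nat _ _ (F2 := fun=> 1)).
    by rewrite sumr_const_nat addKn.
  move=> i /andP[ni ic]; rewrite /F.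
  have -> : i%:R / n.+1%:R - 1 = (i - n.+1)%:R / n.+1%:R :> R.
    by rewrite natrB// mulrBl divff// gt_eqF.
  rewrite ger0_norm ?divr_ge0// ler_pdivrMr// (le_trans _ c1)// ler_nat.
  by rewrite leq_subLR -ltnS -addnS.
have s1 : 0 <= \sum_(0 <= i < n.+1) F i by apply: sumr_ge0 => i _.
have s2 : 0 <= \sum_(n.+1 + c.+1 <= i < (2 * n.+1).+1) F i by apply: sumr_ge0 => i _.
lra.
Qed.

(** A function bounded below on a sub-box has an average at least proportional to the volume
    fraction of that sub-box; the 3 comes from 2n + 3 <= 3(n + 1). *)
Lemma latavg_ge (E : normedModType R) (C : finType) (z0 : E) (D : C -> E) (n : nat)
    (w : E -> R) (theta : C -> R) (c0 : R) :
  (forall c, 0 <= theta c <= 1) -> (forall z, 0 <= w z) -> 0 <= c0 ->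
  (forall y : C -> R, (forall c, `|y c| <= theta c) -> c0 <= w (z0 + \sum_c y c *: D c)) ->
  c0 * \prod_c (theta c / 3) <= latavg z0 D n w.
Proof.
move=> ht w0 c00 hw.
have n0 : 0 < n.+1%:R :> R by rewrite ltr0n.
rewrite /latavg ler_pdivlMr ?card_lat_gt0//.
rewrite card_ffun card_ord natrX -mulrA.
have -> : (2 * n.+1).+1%:R ^+ #|C| = \prod_(c : C) (2 * n.+1).+1%:R :> R by rewrite prodr_const.
rewrite -big_split /=.
apply: (@le_trans _ _ (c0 * \prod_(c : C) \sum_(i : 'I_(2 * n.+1).+1) (`|latcoord R i| <= theta c)%R%:R)).
  apply: ler_wpM2l => //; apply: ler_prod => c _.
  have /andP[t0 t1] := ht c.
  rewrite mulr_ge0 ?divr_ge0//=.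
  apply: le_trans (latcoord_count n (ht c)).
  rewrite -mulrA; apply: ler_wpM2l => //.
  rewrite mulrC ler_pdivrMr// -natrM ler_nat; lia.
rewrite bigA_distr_bigA /= mulr_sumr; apply: ler_sum => a _.
have [/forallP H|/forallPn[c hc]] := boolP [forall c, `|latcoord R (a c)| <= theta c].
  rewrite big1 ?mulr1; first by apply: hw => c; exact: H.
  by move=> c _; rewrite H.
by rewrite (bigD1 c)//= (negbTE hc) mul0r mulr0.
Qed.

Lemma lat_null_calculus (E : normedModType R) (N : nat) (e : 'I_N -> E) (tau z0 : E)
    (a b : R) (K U : set E) (D : option 'I_N -> E) :
  D =1 (fun c => if c is Some k then a *: e k else b *: tau) -> a != 0 -> b != 0 ->
  (forall y : option 'I_N -> R, U (z0 + \sum_c y c *: D c) -> forall c, `|y c| < 1) ->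
  compact K ->
  (forall n (f : {ffun option 'I_N -> 'I_(2 * n.+1).+1}), K (latpt z0 D f)) ->
  null_calculus e tau (vanishes_off U) (null_avg z0 D).
Proof.
move=> DE a0 b0 HU cK latK.
have De k : D (Some k) = a *: e k by rewrite DE.
have Dt : D None = b *: tau by rewrite DE.
split.
- split; [exact: vanishes_offMl|exact: null_avgD|exact: null_avgZ].
- split=> [k g g' vg cg|g g' vg cg].
    have := C1along_dir a cg; rewrite -De => /(null_div HU cK latK vg) /(null_avgZ a^-1).
    by move=> /null_avg_eq; apply => z; rewrite mulKf.
  have := C1along_dir b cg; rewrite -Dt => /(null_div HU cK latK vg) /(null_avgZ b^-1).
  by move=> /null_avg_eq; apply => z; rewrite mulKf.
- move=> k l g gk gl w wk wl vg /(C1along_dir a); rewrite -De => c1.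
  move=> /(C1along_dir a); rewrite -De => c2 /(C1along_dir a); rewrite -De => c3.
  move=> /(C1along_dir a); rewrite -De => c4.
  apply: null_avg_eq (null_avgZ (a^-1 ^+ 2) (null_cross HU cK latK vg c1 c2 c3 c4)) _ => z.
  by field.
- move=> k f f' ft u u' u'' ut vf /(C1along_dir a) c1 /(C1along_dir b) c2.
  move=> /(C1along_dir a) c3 /(C1alongZ a)/(C1along_dir a) c4 /(C1along_dir b) c5.
  rewrite -De in c1 c3 c4; rewrite -Dt in c2 c5.
  apply: null_avg_eq (null_avgZ (a^-1 ^+ 2 * b^-1) (null_time HU cK latK vf c1 c2 c3 c4 c5)) _ => z.
  by field; rewrite a0 b0.
Qed.

End LatticeBounds.

(** * Parabolic boxes *)

Section SpaceTimeBoxes.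
Variables (R : realType) (N : nat).
Local Notation E := ('rV[R]_N * R)%type.

Definition edir (k : 'I_N) : E := (ebase R k, 0).
Definition tdir : E := (0, 1).
Definition unc (u : 'rV[R]_N -> R -> R) (z : E) : R := u z.1 z.2.

Lemma is_derive_line (V : normedModType R) (f : V -> R) (x v : V) :
  derivable f x v -> is_derive (0 : R) 1 (fun s : R => f (x + s *: v)) ('D_v f x).
Proof.
move=> df.
have -> : (fun s : R => f (x + s *: v)) = (fun s => f (s *: v + x)).
  by apply/funext => s; rewrite addrC.
apply: DeriveDef; first exact: (derivable1P f x v).1 df.
rewrite /derive; set g1 := fun h => h^-1 *: _; set g2 := fun h => h^-1 *: _.
suff -> : g1 = g2 by [].
rewrite funeqE /g1 /g2 => h /=.
by rewrite addr0 scale0r add0r [_%:A]mulr1.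
Qed.

Lemma C1along_unc_space k (u : 'rV[R]_N -> R -> R) : jcontinuous u ->
  ex_dx k u -> jcontinuous (dx k u) -> C1along (edir k) (unc u) (unc (dx k u)).
Proof.
move=> cu eu cdu; split => // -[x t].
have := is_derive_line (eu x t); congr is_derive; apply/funext => s.
by rewrite /unc /= scaler0 addr0.
Qed.

Lemma C1along_unc_time (u : 'rV[R]_N -> R -> R) : jcontinuous u ->
  ex_dt u -> jcontinuous (dt u) -> C1along tdir (unc u) (unc (dt u)).
Proof.
move=> cu eu cdu; split => // -[x t].
have := is_derive_line (eu x t); rewrite -derive1E; congr is_derive; apply/funext => s.
by rewrite /unc /= scaler0 addr0.
Qed.

Lemma C21_derivatives_unc (del : R) (u : 'rV[R]_N -> R -> R) : classC21 u ->
  C21_derivatives edir tdir (fun z => unc u z + del) (unc (dt u))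
    (fun k => unc (dx k u)) (fun k l => unc (dx l (dx k u))).
Proof.
move=> [cu [et ct] Hx Hxx]; split.
  have := C1alongD (C1along_unc_time cu et ct) (C1along_cst tdir del).
  by congr C1along; apply/funext => z; rewrite addr0.
move=> k; have [ex cx] := Hx k; split.
  have := C1alongD (C1along_unc_space cu ex cx) (C1along_cst (edir k) del).
  by congr C1along; apply/funext => z; rewrite addr0.
by move=> l; have [exx cxx] := Hxx k l; exact: C1along_unc_space.
Qed.

Lemma C1along_affine (d : E) (f : E -> R) (c : R) : continuous f ->
  (forall z s, f (z + s *: d) = f z + s * c) -> C1along d f (fun=> c).
Proof.
move=> cf fE; split => // z; first exact: cvg_cst.
have -> : (fun s : R => f (z + s *: d)) = (cst (f z)) + (c \*: id).
  by apply/funext => s; rewrite fE /= mulrC.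
have H := @is_deriveZ _ _ _ id c (0 : R) 1 1 (is_derive_id _ _).
have := @is_deriveD _ _ _ _ _ (0 : R) 1 _ _ (is_derive_cst (f z) (0 : R) 1) H.
by rewrite add0r /GRing.scale /= mulr1.
Qed.

Variables (z0 : E) (A : R).
Hypothesis A0 : 0 < A.

Definition relx (k : 'I_N) (z : E) : R := (z.1 0 k - z0.1 0 k) / A.
Definition relt (z : E) : R := (z.2 - z0.2) / A ^+ 2.

Lemma relx_continuous k : continuous (relx k).
Proof.
move=> z; apply: cvgMl; apply: cvgB; last exact: cvg_cst.
apply: (@continuous_comp _ _ _ (fun z : E => z.1) (fun x : 'rV[R]_N => x 0 k)).
  exact: cvg_fst.
exact: coord_continuous.
Qed.

Lemma relt_continuous : continuous relt.
Proof.
move=> z; apply: cvgMl; apply: cvgB; last exact: cvg_cst.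
exact: cvg_snd.
Qed.

Lemma C1along_relx_space k l : C1along (edir k) (relx l) (fun=> (l == k)%:R / A).
Proof.
apply: C1along_affine; first exact: relx_continuous.
by move=> z s; rewrite /relx /= !mxE /=; ring.
Qed.

Lemma C1along_relx_time l : C1along tdir (relx l) (fun=> 0).
Proof.
apply: C1along_affine; first exact: relx_continuous.
by move=> z s; rewrite /relx /= !mxE; ring.
Qed.

Lemma C1along_relt_space k : C1along (edir k) relt (fun=> 0).
Proof.
apply: C1along_affine; first exact: relt_continuous.
by move=> z s; rewrite /relt /= scaler0 addr0 mulr0 addr0.
Qed.

Lemma C1along_relt_time : C1along tdir relt (fun=> (A ^+ 2)^-1).
Proof.
apply: C1along_affine; first exact: relt_continuous.
by move=> z s; rewrite /relt /= /GRing.scale /=; ring.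
Qed.

(** Its positive part is the psi of the cutoff. Being a truncated polynomial, psi has explicit
    derivatives, and two derivatives of a power lower the exponent by at most 2. *)
Definition parab (z : E) : R := 1 - (\sum_k relx k z ^+ 2 + relt z ^+ 2).

Lemma C1along_parab_space k : C1along (edir k) parab (fun z => - 2 * relx k z / A).
Proof.
have := C1alongD (C1along_cst (edir k) 1) (C1alongZ (-1) (C1alongD
  (C1along_sum (index_enum 'I_N) (fun l => C1alongM (C1along_relx_space k l) (C1along_relx_space k l)))
  (C1alongM (C1along_relt_space k) (C1along_relt_space k)))).
congr C1along; apply/funext => z; last first.
  rewrite (bigD1 k)//= eqxx big1 /=; last first.
    by move=> l /negbTE -> /=; ring.
  by ring.
by rewrite /parab mulN1r; congr (_ - (_ + _)).
Qed.

Lemma C1along_parab_time : C1along tdir parab (fun z => - 2 * relt z / A ^+ 2).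
Proof.
have := C1alongD (C1along_cst tdir 1) (C1alongZ (-1) (C1alongD
  (C1along_sum (index_enum 'I_N) (fun l => C1alongM (C1along_relx_time l) (C1along_relx_time l)))
  (C1alongM C1along_relt_time C1along_relt_time))).
congr C1along; apply/funext => z; last first.
  rewrite big1; first by ring.
  by move=> l _; ring.
by rewrite /parab mulN1r; congr (_ - (_ + _)).
Qed.

Variable k0 : nat.

Definition cutoff (z : E) : R := pospow k0.+4 (parab z).
Definition cutoff_t z : R := k0.+4%:R * pospow k0.+3 (parab z) * (- 2 * relt z / A ^+ 2).
Definition cutoff_k k z : R := k0.+4%:R * pospow k0.+3 (parab z) * (- 2 * relx k z / A).
Definition cutoff_kk k z : R := k0.+4%:R *
  (k0.+3%:R * pospow k0.+2 (parab z) * (- 2 * relx k z / A) * (- 2 * relx k z / A)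
   + pospow k0.+3 (parab z) * (- 2 / A ^+ 2)).

Lemma cutoff_cutoff_derivatives :
  cutoff_derivatives edir tdir (vanishes_off (fun z => 0 < parab z))
    cutoff cutoff_t cutoff_k cutoff_kk.
Proof.
have van n z : ~ 0 < parab z -> pospow n.+1 (parab z) = 0.
  by move=> /negP; rewrite -leNgt => /max_idPl; rewrite /pospow => ->; rewrite expr0n.
split.
- by move=> z h; exact: van.
- by move=> k z h; rewrite /cutoff_k van// mulr0 mul0r.
- exact: C1along_pospow C1along_parab_time.
- move=> k; split; first exact: C1along_pospow (C1along_parab_space k).
  have := C1alongZ k0.+4%:R (C1alongM (C1along_pospow k0.+1 (C1along_parab_space k))
    (C1alongZ (- 2 / A) (C1along_relx_space k k))).
  congr C1along; apply/funext => z; rewrite /cutoff_k /cutoff_kk; first by ring.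
  by rewrite eqxx /=; field; rewrite gt_eqF.
Qed.

Lemma parab_le1 z : parab z <= 1.
Proof.
rewrite /parab lerBlDr lerDl addr_ge0 ?sqr_ge0// sumr_ge0// => k _; exact: sqr_ge0.
Qed.

Lemma pospow_parab_ge0 n z : 0 <= pospow n (parab z).
Proof. exact: pospow_ge0. Qed.

Lemma pospow_parab_S n z : pospow n.+1 (parab z) <= pospow n (parab z).
Proof.
rewrite /pospow exprS ler_piMl// ?exprn_ge0 ?le_max ?lexx//.
by rewrite ge_max ler01 parab_le1.
Qed.

Lemma pospow_relx n k z : pospow n.+1 (parab z) * relx k z ^+ 2 <= pospow n.+1 (parab z).
Proof.
have [h|h] := leP (parab z) 0; first by rewrite /pospow (max_idPl h) expr0n mul0r.
rewrite ler_piMr ?pospow_ge0//; move: h; rewrite /parab subr_gt0 => h.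
apply: ltW; apply: le_lt_trans h; rewrite (bigD1 k)//= -addrA lerDl addr_ge0 ?sqr_ge0//.
by apply: sumr_ge0 => l _; exact: sqr_ge0.
Qed.

Lemma pospow_relt n z : pospow n.+1 (parab z) * `|relt z| <= pospow n.+1 (parab z).
Proof.
have [h|h] := leP (parab z) 0; first by rewrite /pospow (max_idPl h) expr0n mul0r.
rewrite ler_piMr ?pospow_ge0//; move: h; rewrite /parab subr_gt0 => h.
rewrite -(@ler_pXn2r _ 2)// ?nnegrE// expr1n real_normK ?num_real//.
apply: ltW; apply: le_lt_trans h; rewrite lerDr.
by apply: sumr_ge0 => l _; exact: sqr_ge0.
Qed.

(** With c = [k0.+4], the time derivative needs 2c, the Laplacian 4c^2 + 2c <= 6c^2 per coordinate,
    and the squared gradient 4c^2 per coordinate. *)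
Definition cutoff_const : R := 2 * k0.+4%:R + 6 * N%:R * k0.+4%:R ^+ 2.
Definition cutoffP z : R := pospow k0.+2 (parab z) / A ^+ 2.
Definition cutoffQ z : R := pospow k0 (parab z) / A ^+ 4.

Lemma cutoff_weights z :
  [/\ 0 <= cutoff z, 0 <= cutoffP z, 0 <= cutoffQ z & cutoffP z ^+ 2 = cutoff z * cutoffQ z].
Proof.
split; rewrite ?divr_ge0 ?pospow_ge0 ?exprn_ge0 ?(ltW A0)//.
rewrite /cutoffP /cutoff /cutoffQ /pospow -[k0.+4]addn4 -[k0.+2]addn2 !exprD.
by field; rewrite gt_eqF.
Qed.

Lemma cutoff_bounds z : [/\ `|cutoff_t z| <= cutoff_const * cutoffP z,
  `|\sum_k cutoff_kk k z| <= cutoff_const * cutoffP z &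
  \sum_k cutoff_k k z ^+ 2 <= cutoff_const * cutoff z * cutoffP z].
Proof.
have A20 : 0 < A ^+ 2 by rewrite exprn_gt0.
have p0 n := pospow_parab_ge0 n z.
set c : R := k0.+4%:R.
have c1 : 1 <= c by rewrite ler1n.
have c0 : 0 <= c by apply: le_trans c1.
have n0 : 0 <= N%:R :> R by [].
have c20 : 0 <= c ^+ 2 by exact: sqr_ge0.
have ccst : cutoff_const = 2 * c + 6 * N%:R * c ^+ 2 by [].
have P0 : 0 <= cutoffP z by have [] := cutoff_weights z.
have nc0 : 0 <= N%:R * c ^+ 2 by rewrite mulr_ge0.
split.
- have -> : cutoff_t z = - (2 * c * (pospow k0.+3 (parab z) * relt z) / A ^+ 2).
    by rewrite /cutoff_t -/c; ring.
  rewrite normrN normf_div (gtr0_norm A20) (normrM (2 * c)) (normrM 2) (ger0_norm c0).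
  rewrite (normrM (pospow _ _)) (ger0_norm (p0 _)).
  rewrite normr_nat.
  apply: (@le_trans _ _ (2 * c * cutoffP z)).
    rewrite /cutoffP [leRHS]mulrA ler_pM2r ?invr_gt0//.
    rewrite ler_wpM2l ?mulr_ge0//.
    by apply: le_trans (pospow_relt _ _) (pospow_parab_S _ _).
  by rewrite ler_wpM2r// ccst lerDl -mulrA mulr_ge0.
- apply: (@le_trans _ _ (\sum_(k < N) 6 * c ^+ 2 * cutoffP z)); last first.
    rewrite sumr_const card_ord -[leLHS]mulr_natr ccst.
    rewrite (_ : 6 * c ^+ 2 * cutoffP z * N%:R = 6 * N%:R * c ^+ 2 * cutoffP z); last by ring.
    by rewrite ler_wpM2r// lerDr mulr_ge0.
  apply: le_trans (ler_norm_sum _ _ _) _; apply: ler_sum => k _.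
  have -> : cutoff_kk k z = c / A ^+ 2 * (4 * k0.+3%:R * (pospow k0.+2 (parab z) * relx k z ^+ 2)
      - 2 * pospow k0.+3 (parab z)).
    by rewrite /cutoff_kk -/c; field; rewrite gt_eqF.
  have -> : 6 * c ^+ 2 * cutoffP z = c / A ^+ 2 * (6 * c * pospow k0.+2 (parab z)).
    by rewrite /cutoffP; field; rewrite gt_eqF.
  rewrite normrM ger0_norm ?divr_ge0 ?(ltW A20)//; apply: ler_wpM2l.
    by rewrite divr_ge0// ltW.
  have h1 := pospow_relx k0.+1 k z.
  have h2 := pospow_parab_S k0.+2 z.
  have h3 : 0 <= pospow k0.+2 (parab z) * relx k z ^+ 2 by rewrite mulr_ge0// sqr_ge0.
  have k3c : k0.+3%:R <= c by rewrite ler_nat.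
  have h4 : k0.+3%:R * (pospow k0.+2 (parab z) * relx k z ^+ 2) <= c * pospow k0.+2 (parab z).
    by apply: ler_pM.
  have h5 : 1 * pospow k0.+2 (parab z) <= c * pospow k0.+2 (parab z) by rewrite ler_wpM2r.
  have h6 := p0 k0.+3.
  have h7 : 0 <= k0.+3%:R * (pospow k0.+2 (parab z) * relx k z ^+ 2) by rewrite mulr_ge0.
  rewrite ler_norml; apply/andP; split; lra.
- apply: (@le_trans _ _ (\sum_(k < N) 4 * c ^+ 2 * (cutoff z * cutoffP z))); last first.
    rewrite sumr_const card_ord -[leLHS]mulr_natr ccst -[leRHS]mulrA.
    have h : 0 <= cutoff z * cutoffP z by rewrite mulr_ge0//; exact: p0.
    rewrite (_ : 4 * c ^+ 2 * (cutoff z * cutoffP z) * N%:R = 4 * N%:R * c ^+ 2 * (cutoff z * cutoffP z)); last by ring.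
    rewrite ler_wpM2r//; lra.
  apply: ler_sum => k _.
  have -> : cutoff_k k z ^+ 2 = 4 * c ^+ 2 / A ^+ 2 * pospow k0.+2 (parab z) * (pospow k0.+4 (parab z) * relx k z ^+ 2).
    rewrite /cutoff_k -/c.
    have e : pospow k0.+3 (parab z) ^+ 2 = pospow k0.+2 (parab z) * pospow k0.+4 (parab z).
      by rewrite /pospow -exprM -exprD; congr (_ ^+ _); lia.
    transitivity (4 * c ^+ 2 / A ^+ 2 * relx k z ^+ 2 * pospow k0.+3 (parab z) ^+ 2).
      by field; rewrite gt_eqF.
    by rewrite e; ring.
  have -> : 4 * c ^+ 2 * (cutoff z * cutoffP z) =
      4 * c ^+ 2 / A ^+ 2 * pospow k0.+2 (parab z) * cutoff z.
    by rewrite /cutoffP; field; rewrite gt_eqF.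
  rewrite ler_wpM2l//; last exact: pospow_relx.
  by rewrite mulr_ge0// divr_ge0 ?mulr_ge0// ltW.
Qed.

End SpaceTimeBoxes.

(** * The lattice over a parabolic box of size A in space and A^2 in time *)

Section Box.
Variables (R : realType) (N : nat) (z0 : 'rV[R]_N * R) (A : R).
Hypothesis A0 : 0 < A.
Local Notation E := ('rV[R]_N * R)%type.

Definition boxdir (c : option 'I_N) : E :=
  if c is Some k then A *: edir R k else A ^+ 2 *: tdir R N.

Definition box : set E :=
  [set x : 'rV[R]_N | forall k, `[z0.1 0 k - A, z0.1 0 k + A]%classic (x ord0 k)]
  `*` `[z0.2 - A ^+ 2, z0.2 + A ^+ 2]%classic.

Lemma compact_box : compact box.
Proof.
apply: compact_setX; last exact: segment_compact.
by apply: (rV_compact (A := fun k => `[z0.1 0 k - A, z0.1 0 k + A]%classic)) => k; exact: segment_compact.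
Qed.

Lemma box_fst (y : option 'I_N -> R) k :
  (z0 + \sum_c y c *: boxdir c).1 0 k = z0.1 0 k + y (Some k) * A.
Proof.
rewrite /= (big_morph (fun z : E => z.1) (fun _ _ => erefl) erefl) mxE summxE.
rewrite (bigD1 (Some k))//= big1 ?addr0; first by rewrite !mxE !eqxx mulr1.
by case=> [l lk|_]; rewrite !mxE ?mulr0// (_ : k == l = false) ?andbF ?mulr0//;
  apply/negbTE; apply: contra_neq lk => ->.
Qed.

Lemma box_snd (y : option 'I_N -> R) :
  (z0 + \sum_c y c *: boxdir c).2 = z0.2 + y None * A ^+ 2.
Proof.
rewrite /= (big_morph (fun z : E => z.2) (fun _ _ => erefl) erefl).
rewrite (bigD1 None)//= big1 ?addr0; first by rewrite /GRing.scale /= mulr1.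
by case=> [l _|//]; rewrite /= !scaler0.
Qed.

Lemma relx_box y k : relx z0 A k (z0 + \sum_c y c *: boxdir c) = y (Some k).
Proof. by rewrite /relx box_fst addrC addKr mulfK// gt_eqF. Qed.

Lemma relt_box y : relt z0 A (z0 + \sum_c y c *: boxdir c) = y None.
Proof. by rewrite /relt box_snd addrC addKr mulfK// gt_eqF// exprn_gt0. Qed.

Lemma parab_box (y : option 'I_N -> R) : 0 < parab z0 A (z0 + \sum_c y c *: boxdir c) ->
  forall c, `|y c| < 1.
Proof.
rewrite /parab subr_gt0 relt_box; under eq_bigr do rewrite relx_box.
have s0 (P : pred 'I_N) : 0 <= \sum_(i | P i) y (Some i) ^+ 2.
  by apply: sumr_ge0 => i _; exact: sqr_ge0.
move=> h c; rewrite -(@ltr_pXn2r _ 2)// ?nnegrE// expr1n real_normK ?num_real//.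
apply: le_lt_trans h; case: c => [k|]; last by rewrite lerDr.
by rewrite (bigD1 k)//= -addrA lerDl addr_ge0// sqr_ge0.
Qed.

Lemma latcoord_le1 n (i : 'I_(2 * n.+1).+1) : `|latcoord R i| <= 1.
Proof.
have n0 : 0 < n.+1%:R :> R by rewrite ltr0n.
rewrite /latcoord ler_norml lerBrDl subrr divr_ge0//= lerBlDr ler_pdivrMr//.
by rewrite -[1 + 1]/(2%:R) -natrM ler_nat -ltnS.
Qed.

Lemma latpt_box n (f : {ffun option 'I_N -> 'I_(2 * n.+1).+1}) : box (latpt z0 boxdir f).
Proof.
split.
  move=> /= k; rewrite /latpt (box_fst (fun c => latcoord R (f c))) in_itv /=.
  have := latcoord_le1 (f (Some k)); rewrite ler_norml => /andP[h1 h2].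
  by rewrite lerD2l lerD2l -mulN1r ler_pM2r// h1 ler_piMl// ltW.
have := box_snd (fun c => latcoord R (f c)); rewrite -/(latpt z0 boxdir f).
move: (latpt _ _ _) => p e; rewrite /mkset /= in_itv /= e.
have := latcoord_le1 (f None); rewrite ler_norml => /andP[h1 h2].
have A20 : 0 < A ^+ 2 by rewrite exprn_gt0.
by rewrite lerD2l lerD2l -mulN1r ler_pM2r// h1 ler_piMl// ltW.
Qed.

Lemma box_null_calculus :
  null_calculus (@edir R N) (tdir R N) (vanishes_off (fun z => 0 < parab z0 A z))
    (null_avg z0 boxdir).
Proof.
apply: (@lat_null_calculus R _ N (@edir R N) (tdir R N) z0 A (A ^+ 2) box).
- by [].
- by rewrite gt_eqF.
- by rewrite gt_eqF// exprn_gt0.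
- exact: parab_box.
- exact: compact_box.
- exact: latpt_box.
Qed.

End Box.

(** * Effect of the shift delta on the source *)

Section SourceModulus.
Variable R : realType.

Lemma abs_powR_continuous (r : R) : 0 < r -> continuous (fun s : R => `|s| `^ r).
Proof.
move=> r0 s; have [->|s0] := eqVneq s 0.
  apply/cvgrPdist_lt => e e0; rewrite normr0 powR0 ?gt_eqF//.
  have d0 : 0 < e `^ r^-1 by exact: powR_gt0.
  have eE : (e `^ r^-1) `^ r = e by rewrite -powRrM mulVf ?gt_eqF// powRr1// ltW.
  have := @nbhs0_lt R R _ d0; apply: filterS => x xd.
  rewrite sub0r normrN ger0_norm ?powR_ge0// -[ltRHS]eE.
  by apply: gt0_ltr_powR => //; rewrite ?nnegrE ?(ltW d0).
apply: (@continuous_comp _ _ _ (fun s : R => `|s|) (fun s => s `^ r)).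
  exact: norm_continuous.
apply: (@is_derive1_continuous R _ _ (r * `|s| `^ (r - 1))).
by apply: is_derive1_powR; rewrite normr_gt0.
Qed.

Lemma sum_continuous (T : topologicalType) (I : Type) (s : seq I) (f : I -> T -> R) :
  (forall i, continuous (f i)) -> continuous (fun z => \sum_(i <- s) f i z).
Proof.
move=> cf; elim: s => [|i s IH] z.
  under [X in continuous_at _ X]eq_fun do rewrite big_nil.
  exact: cvg_cst.
under [X in continuous_at _ X]eq_fun do rewrite big_cons.
by apply: cvgD; [exact: cf|exact: IH].
Qed.

(** The shift is treated as an extra real variable: uniform continuity near the compact set [K]
    times {0} gives the claim. The absolute values inside [G] make it continuous everywhere and
    change nothing where the arguments are nonnegative. *)
Lemma source_modulus (E : normedModType R) (m : nat) (B : 'M[R]_m) (r : R)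
    (u : 'I_m -> E -> R) (K : set E) (eta : R) :
  0 < r -> (forall i, continuous (u i)) -> (forall i z, 0 <= u i z) -> compact K ->
  0 < eta -> exists2 del : R, 0 < del & forall i z, K z ->
    `|source B r u i z - source B r (fun j z => u j z + del) i z| <= eta.
Proof.
move=> r0 cu u0 cK eta0.
have H i : exists del : R, 0 < del /\ forall d z, 0 <= d < del -> K z ->
    `|source B r u i z - source B r (fun j z => u j z + d) i z| <= eta.
  pose w j (p : E * R) := u j p.1 + p.2.
  have cw j : continuous (w j).
    move=> p; apply: cvgD; last exact: cvg_snd.
    by apply: (@continuous_comp _ _ _ fst (u j)); [exact: cvg_fst|exact: cu].
  have cpw j : continuous (fun p => `|w j p| `^ r).
    move=> p; apply: (@continuous_comp _ _ _ (w j) (fun s => `|s| `^ r)); first exact: cw.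
    exact: abs_powR_continuous.
  pose G p := \sum_j B i j * (`|w i p| `^ r * (`|w j p| `^ r * w j p)).
  have cG : continuous G.
    apply: sum_continuous => j p.
    apply: cvgM; first exact: cvg_cst.
    by apply: cvgM; [exact: cpw|apply: cvgM; [exact: cpw|exact: cw]].
  have cK0 : compact (K `*` [set 0 : R]) by apply: compact_setX => //; exact: compact_set1.
  have [del del0 Hdel] := compact_unif_cont cK0 cG eta0.
  exists del; split => // d z /andP[d0 ddel] Kz.
  have := Hdel (z, 0) (z, d) (conj Kz erefl).
  have -> : `|(z, d) - (z, 0)| = `|d|.
    rewrite -[LHS]/(Num.max `|z - z| `|d - 0|) subrr normr0 subr0.
    by apply/max_idPr; exact: normr_ge0.
  rewrite (ger0_norm d0) => /(_ ddel); rewrite distrC.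
  congr (`| _ - _ | <= _); apply: eq_bigr => j _; rewrite /w /=.
    by rewrite !addr0 !ger0_norm.
  by rewrite !ger0_norm// addr_ge0.
have [f Hf] := choice H.
pose del := (\big[Num.min/1]_i f i) / 2.
have m0 : 0 < \big[Num.min/1]_i f i.
  by apply: lt_bigmin => // i _; have [] := Hf i.
exists del; first by rewrite divr_gt0.
move=> i z Kz; have [_] := Hf i; apply => //.
rewrite divr_ge0 ?(ltW m0)//=.
apply: (@lt_le_trans _ _ (\big[Num.min/1]_i f i)); last exact: bigmin_le_cond.
by rewrite /del ltr_pdivrMr// ltr_pMr// ltr1n.
Qed.

End SourceModulus.

(** * Comparison of exponents *)

Section Growth.
Variable R : realType.

(** The claim is (N - 2) r < 2, that is p < p_S(N). For N >= 2 it follows from 2r (N-1)^2 < N(N+2) -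
    (N-1)^2 = 4N - 1 and (4N - 1)(N - 2) < 4(N - 1)^2. *)
Lemma subcritical_decay (N : nat) (r : R) : (1 <= N)%N -> 0 < r ->
  ((2 * r + 1)%:E < pB R N)%E -> (N + 2)%:R < 4 + 2 / r.
Proof.
rewrite /pB => N1 r0; rewrite natrD -[_ + 2]/(_ + (1 + 1)).
suff : (N%:R - 2) * r < 2 -> N%:R + 2 < 4 + 2 / r :> R.
  move=> suf; case: eqP => [->|/eqP N1' hp].
    by move=> _; have : 0 < 2 / r by [rewrite divr_gt0]; lra.
  apply: suf.
  have {hp} : 2 * r + 1 < N%:R * (N%:R + 2) / (N%:R - 1) ^+ 2 by rewrite -lte_fin.
  have n2 : 2 <= N%:R :> R by rewrite ler_nat ltn_neqAle eq_sym N1'.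
  move: (N%:R : R) n2 => n n2.
  have n10 : 0 < n - 1 by lra.
  have n20 : 0 < (n - 1) ^+ 2 by rewrite exprn_gt0.
  rewrite ltr_pdivlMr// => hp.
  have {}hp : 2 * r * (n - 1) ^+ 2 <= 4 * n - 1 by move: hp; rewrite !expr2; lra.
  have k : (2 * r * (n - 1) ^+ 2) * (n - 2) <= (4 * n - 1) * (n - 2).
    by rewrite ler_wpM2r// subr_ge0.
  rewrite -(ltr_pM2r n20).
  have -> : (n - 2) * r * (n - 1) ^+ 2 = (2 * r * (n - 1) ^+ 2) * (n - 2) / 2 by field.
  rewrite ltr_pdivrMr//; apply: le_lt_trans k _; rewrite expr2; lra.
rewrite -ltr_pdivlMr// => h; lra.
Qed.

Lemma powR_growth_contradiction (n : nat) (X C gamma A1 : R) : 0 < X -> 0 < A1 ->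
  n%:R < gamma ->
  (forall A, A1 <= A -> X / A ^+ n <= C * A `^ (- gamma)) -> False.
Proof.
move=> X0 A10 ng H.
pose g := gamma - n%:R.
have g0 : 0 < g by rewrite subr_gt0.
pose Y := `|C| / X + 1.
have Y0 : 0 < Y by rewrite ltr_wpDl// divr_ge0// ltW.
pose A := Num.max A1 (Y `^ g^-1).
have AA1 : A1 <= A by rewrite le_max lexx.
have A0 : 0 < A by apply: lt_le_trans AA1.
have AY : Y <= A `^ g.
  rewrite -[leLHS](@powRr1 _ Y) ?(ltW Y0)// -(@mulVf _ g) ?gt_eqF// powRrM.
  by apply: ge0_ler_powR; rewrite ?nnegrE ?powR_ge0 ?(ltW g0) ?(ltW A0)// le_max lexx orbT.
have := H A AA1.
have -> : - gamma = - n%:R - g by rewrite /g; ring.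
rewrite powRD; last by rewrite (gt_eqF A0) implybT.
rewrite !powRN powR_mulrn ?(ltW A0)//.
have An : 0 < A ^+ n by rewrite exprn_gt0.
have Ag : 0 < A `^ g by rewrite powR_gt0.
rewrite mulrCA mulrC ler_pM2l ?invr_gt0// ler_pdivlMr// => h.
have := ler_wpM2l (ltW X0) AY.
rewrite /Y mulrDr mulrCA divff ?gt_eqF// !mulr1.
have := ler_norm C; lra.
Qed.

End Growth.

(** * Conclusion *)

Section Conclusion.
Variables (R : realType) (N m : nat) (r : R) (B : 'M[R]_m).
Local Notation E := ('rV[R]_N * R)%type.
Hypotheses (N1 : (1 <= N)%N) (r0 : 0 < r) (hp : ((2 * r + 1)%:E < pB R N)%E).
Hypotheses (Bsym : B^T = B) (B0 : forall i j, 0 <= B i j) (Bd : forall i, 0 < B i i).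

(* The decay exponent [4 + 2 / r] is [4 p / (p - 1)] with [p = 2 r + 1]. *)
Lemma box_estimate : exists (k0 : nat) (C : R),
  forall (u : 'I_m -> 'rV[R]_N -> R -> R), classical_solution r B u -> nonnegative u ->
  forall (z0 : E) (A : R), 1 <= A ->
  exists (v : 'I_m -> E -> R) (Z : E -> R),
    [/\ null_avg z0 (boxdir A) Z, forall i z, unc (u i) z <= v i z &
      forall z, box z0 A z ->
        cutoff z0 A k0 z * \sum_i (v i z `^ r * (v i z `^ r * v i z)) ^+ 2 <=
          Z z + C * A `^ (- (4 + 2 / r))].
Proof.
have [b [b0 bk kp]] := subcritical_weight N1 r0 hp.
pose k0 := (Num.truncn (2 / r)).+1.
have hk0 : 2 / r <= k0%:R by apply/ltW/truncnS_gt.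
have C10 : 0 <= cutoff_const R N k0.
  by rewrite addr_ge0 ?mulr_ge0// sqr_ge0.
have [c0 [C [c00 C0 Hest]]] := system_estimate N1 r0 b0 bk kp C10 Bsym B0 Bd.
(* With this [eta] the Young term, multiplied by [C], is at most half of the left side and is
   absorbed there. *)
have eta0 : 0 < c0 / (2 * (C + 1)) by rewrite divr_gt0// mulr_gt0// ltr_wpDl.
have [C3 C30 Hyoung] := powR_young r0 eta0.
exists k0, (2 / c0 * (m%:R * C * (C3 + 1))) => u [uC ueq] u0 z0 A A1.
have A0 : 0 < A by apply: lt_le_trans A1.
pose g := 4 + 2 / r.
have g0 : 0 <= g by rewrite addr_ge0// divr_ge0// ltW.
have Ag0 : 0 < A `^ (- g) by exact: powR_gt0.
have Ag1 : A `^ (- g) <= 1.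
  by rewrite powRN invf_le1 ?powR_gt0// -[leLHS](powRr0 A); exact: ler_powR.
have cu i : continuous (unc (u i)) by have [] := uC i.
have uu0 i z : 0 <= unc (u i) z by exact: u0.
(* The shift depends on A: it makes the error at most A^(-g) on the box, and since A^(-g) <= 1 the
   squared error is no larger. *)
have [del del0 Hdel] := source_modulus B r0 cu uu0 (@compact_box R N z0 A) Ag0.
pose v i z := unc (u i) z + del.
have v0 i z : 0 < v i z by rewrite ltr_wpDl.
have [Z nZ HZ] := Hest _ _ _ _ _ _ _ _ _ _ _ v (fun i => unc (dt (u i)))
  (fun i k => unc (dx k (u i))) (fun i k l => unc (dx l (dx k (u i))))
  (box_null_calculus z0 A0) (cutoff_cutoff_derivatives z0 A0 k0)
  (cutoff_weights z0 A0 k0) (cutoff_bounds z0 A0 k0)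
  (fun i => C21_derivatives_unc del (uC i)) v0.
exists v, (fun z => 2 / c0 * Z z); split.
- exact: null_avgZ.
- by move=> i z; rewrite lerDl ltW.
move=> z Kz.
have := HZ z.
set q := fun i => v i z `^ r * (v i z `^ r * v i z).
have [ph0 _ _ _] := cutoff_weights z0 A0 k0 z.
have ph1 : cutoff z0 A k0 z <= 1.
  by rewrite exprn_ile1// ?le_max ?lexx// ge_max ler01 parab_le1.
(* A constant shift does not change derivatives, so the residual of [v] is the difference of the
   sources at [u] and at [v]. *)
have eE i : unc (dt (u i)) z - lap (fun k l => unc (dx l (dx k (u i)))) z - source B r v i z
    = source B r (fun i => unc (u i)) i z - source B r v i z.
  congr (_ - _); rewrite /unc /lap -[X in _ - X]/(laplacian (u i) z.1 z.2) ueq.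
  apply: eq_bigr => j _; rewrite -mulrA powRD ?powRr1//.
  by rewrite gt_eqF// addr_gt0.
have e2 i : (unc (dt (u i)) z - lap (fun k l => unc (dx l (dx k (u i)))) z
     - source B r v i z) ^+ 2 <= A `^ (- g).
  rewrite eE -real_normK ?num_real// expr2 -[leRHS]mulr1.
  have h := Hdel i z Kz.
  by apply: ler_pM => //; exact: le_trans h Ag1.
have terms i : cutoffQ z0 A k0 z * v i z ^+ 2 + cutoff z0 A k0 z *
    (unc (dt (u i)) z - lap (fun k l => unc (dx l (dx k (u i)))) z - source B r v i z) ^+ 2
    <= c0 / (2 * (C + 1)) * (cutoff z0 A k0 z * q i ^+ 2) + (C3 + 1) * A `^ (- g).
  rewrite (mulrDl C3) mul1r addrA; apply: lerD.
    have hpsi : 0 <= Num.max 0 (parab z0 A z) <= 1.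
      by rewrite le_max lexx/= ge_max ler01 parab_le1.
    have := Hyoung k0 _ A (v i z) hk0 hpsi A0 (v0 i z).
    by rewrite addn4.
  by rewrite -[leRHS]mul1r; apply: ler_pM => //; exact: sqr_ge0.
move=> h.
have {}h := le_trans h (lerD (lexx (Z z)) (ler_wpM2l C0 (ler_sum _ (fun i _ => terms i)))).
rewrite big_split /= sumr_const card_ord -!mulr_sumr -[X in _ * (_ + X)]mulr_natr in h.
set S := cutoff _ _ _ _ * \sum_i _ in h *.
have S0 : 0 <= S by rewrite mulr_ge0// sumr_ge0// => i _; exact: sqr_ge0.
have k1 : C * (c0 / (2 * (C + 1)) * S) <= c0 / 2 * S.
  have -> : C * (c0 / (2 * (C + 1)) * S) = c0 / 2 * S * (C / (C + 1)).
    by field; rewrite gt_eqF// ltr_wpDl.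
  rewrite ler_piMr//; first by rewrite mulr_ge0// divr_ge0// ltW.
  by rewrite ler_pdivrMr ?ltr_wpDl// mul1r lerDl.
have k2 : c0 / 2 * S <= Z z + m%:R * C * (C3 + 1) * A `^ (- g) by lra.
have := ler_wpM2l (_ : 0 <= 2 / c0) k2; rewrite divr_ge0 ?(ltW c00)// => /(_ isT).
have -> : 2 / c0 * (c0 / 2 * S) = S by field; rewrite gt_eqF.
by rewrite mulrDr !mulrA.
Qed.

Lemma liouville (u : 'I_m -> 'rV[R]_N -> R -> R) :
  classical_solution r B u -> nonnegative u -> ~ nontrivial u.
Proof.
move=> usol u0 [i0 [x0 [t0 ui0]]].
have [k0 [C Hbox]] := box_estimate.
pose z0 : E := (x0, t0).
have cu : continuous (unc (u i0)) by have [uC _] := usol; have [] := uC i0.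
pose c := unc (u i0) z0 / 2.
have uz0 : 0 < unc (u i0) z0 by rewrite lt_neqAle eq_sym ui0 u0.
have c0 : 0 < c by rewrite divr_gt0.
have [rho [rho0 rho1 Hrho]] : exists rho : R, [/\ 0 < rho, rho <= 1 &
    forall z : E, (forall k, `|z.1 0 k - x0 0 k| <= rho) -> `|z.2 - t0| <= rho ->
      c <= unc (u i0) z].
  have /cvgrPdist_lt /(_ _ c0) := cu z0.
  move=> /nbhs_ballP[e /= e0 he].
  exists (Num.min 1 (e / 2)); split; rewrite ?lt_min ?ltr01 ?divr_gt0 ?ge_min ?lexx//.
  have rhoe : Num.min 1 (e / 2) < e.
    by rewrite gt_min; apply/orP; right; rewrite ltr_pdivrMr// ltr_pMr// ltr1n.
  move=> z hx hz; have : `|unc (u i0) z0 - unc (u i0) z| < c.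
    apply: he; split=> /=.
      by split=> // i j; rewrite ord1 -ball_normE /= distrC; exact: le_lt_trans (hx j) rhoe.
    by rewrite -ball_normE /= distrC; exact: le_lt_trans hz rhoe.
  by rewrite ltr_norml => /andP[_]; rewrite /c; lra.
(* A lower bound for the integrand near [z0], where [parab] is at least 1/2 and one component at
   least [c]. *)
pose cw := (2^-1) ^+ k0.+4 * (c `^ r * (c `^ r * c)) ^+ 2.
have cq0 : 0 < c `^ r * (c `^ r * c) by rewrite !mulr_gt0// powR_gt0.
have cw0 : 0 < cw by rewrite mulr_gt0// exprn_gt0// invr_gt0.
have X0 : 0 < cw * (rho / 3) ^+ N.+1 by rewrite mulr_gt0// exprn_gt0// divr_gt0.
have A10 : 0 < 2 * N.+1%:R :> R by rewrite mulr_gt0.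
apply: (powR_growth_contradiction X0 A10 (subcritical_decay N1 r0 hp) (C := C)).
move=> A AA1.
have n1 : 1 <= N.+1%:R :> R by rewrite ler1n.
have A1 : 1 <= A by apply: le_trans AA1; lra.
have A0 : 0 < A by apply: lt_le_trans A1.
have A20 : 0 < A ^+ 2 by rewrite exprn_gt0.
have AA2 : A <= A ^+ 2 by rewrite expr2 ler_peMr// ltW.
have A21 : 1 <= A ^+ 2 by apply: le_trans AA2.
have [v [Z [nZ uv HZ]]] := Hbox u usol u0 z0 A A1.
(* The box of fixed half-width [rho] around [z0], measured in the rescaled coordinates. *)
pose theta (d : option 'I_N) : R := if d is Some _ then rho / A else rho / A ^+ 2.
have ht d : 0 <= theta d <= 1.
  by case: d => [k|]; rewrite /theta divr_ge0 ?(ltW rho0) ?(ltW A0) ?(ltW A20)//=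
     ler_pdivrMr// mul1r (le_trans rho1).
pose w z := cutoff z0 A k0 z * \sum_i (v i z `^ r * (v i z `^ r * v i z)) ^+ 2.
have w0 z : 0 <= w z.
  have [ph0 _ _ _] := cutoff_weights z0 A0 k0 z.
  by rewrite mulr_ge0// sumr_ge0// => i _; exact: sqr_ge0.
have hw (y : option 'I_N -> R) : (forall d, `|y d| <= theta d) ->
    cw <= w (z0 + \sum_d y d *: boxdir A d).
  move=> hy; set z := z0 + _.
  have uc : c <= unc (u i0) z.
    apply: Hrho => [k|].
      by rewrite /z box_fst addrC addKr normrM (gtr0_norm A0) -ler_pdivlMr//; exact: (hy (Some k)).
    by rewrite /z box_snd addrC addKr normrM (gtr0_norm A20) -ler_pdivlMr//; exact: (hy None).
  (* The N + 1 squares in [parab] then sum to at most (N+1)/A, which is at most 1/2 because A >=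
     2(N+1). *)
  have y2 d : y d ^+ 2 <= A^-1.
    have thA : theta d <= A^-1.
      case: (d) => [k|]; rewrite /theta.
        by rewrite ler_pdivrMr// mulVf ?gt_eqF.
      by rewrite ler_pdivrMr// expr2 mulrA mulVf ?gt_eqF// mul1r (le_trans rho1).
    have [/andP[_ th1] yd] := (ht d, hy d).
    rewrite -real_normK ?num_real// expr2 -[leRHS]mulr1.
    by apply: ler_pM => //; [exact: le_trans thA|exact: le_trans th1].
  have hpar : 2^-1 <= parab z0 A z.
    rewrite /parab /z relt_box//; under eq_bigr do rewrite relx_box//.
    have : \sum_(k < N) y (Some k) ^+ 2 <= \sum_(k < N) A^-1 by apply: ler_sum => k _.
    rewrite sumr_const card_ord -[X in _ <= X]mulr_natr => h1.
    have h2 : A^-1 * N.+1%:R <= 2^-1.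
      by rewrite mulrC ler_pdivrMr// mulrC ler_pdivlMr// mulrC.
    by move: (y2 None) h2; rewrite -natr1 mulrDr mulr1; lra.
  apply: ler_pM.
  - by rewrite exprn_ge0// invr_ge0.
  - exact: sqr_ge0.
  - rewrite /cutoff /pospow lerXn2r ?nnegrE ?invr_ge0 ?le_max ?lexx ?hpar ?orbT//.
  - rewrite (bigD1 i0)//= -[leLHS]addr0 lerD//; last first.
      by apply: sumr_ge0 => i _; exact: sqr_ge0.
    have cv : c <= v i0 z by apply: le_trans (uv i0 z).
    have cr : c `^ r <= v i0 z `^ r.
      by apply: ge0_ler_powR; rewrite ?nnegrE ?(ltW r0) ?(ltW c0)// (le_trans (ltW c0)).
    rewrite lerXn2r ?nnegrE ?(ltW cq0)//.
      by rewrite !mulr_ge0 ?powR_ge0// (le_trans (ltW c0)).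
    by rewrite !ler_pM ?mulr_ge0 ?powR_ge0// ltW.
have low n := latavg_ge n ht w0 (ltW cw0) hw.
have up n : latavg z0 (boxdir A) n w <= latavg z0 (boxdir A) n Z + C * A `^ (- (4 + 2 / r)).
  rewrite -[X in _ + X](latavg_cst z0 (boxdir A) n) -latavgD; apply: latavg_le => a.
  exact/HZ/latpt_box.
(* The N space directions contribute A^N and the time direction A^2, whence the exponent N + 2. *)
have prodE : \prod_d (theta d / 3) = (rho / 3) ^+ N.+1 / A ^+ (N + 2).
  rewrite (bigD1 None)//= (eq_bigr (fun=> rho / A / 3)); last by case.
  rewrite prodr_const cardC1 card_option card_ord /=.
  rewrite exprD !expr_div_n !exprSr.
  by field; rewrite ?expf_neq0 ?gt_eqF.
rewrite -mulrA -prodE.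
(* A is fixed here, so a single mesh fine enough to make the average of [Z] at most [e] suffices. *)
apply/ler_addgt0Pr => e e0.
have /cvgr0Pnorm_le /(_ e e0) [n _ /(_ n (leqnn n)) hn] := nZ.
apply: le_trans (low n) _; apply: le_trans (up n) _.
by rewrite addrC lerD2l (le_trans (ler_norm _)).
Qed.

End Conclusion.

Theorem theorem2p1 (R : realType) (N m : nat) (r : R) (B : 'M[R]_m)
  (hN : (1 <= N)%N) (hm : (2 <= m)%N) (hr : 0 < r)
  (hp : ((2 * r + 1)%:E < pB R N)%E)
  (Bsym : B^T = B)
  (Boff : forall i j : 'I_m, i != j -> 0 <= B i j)
  (Bdiag : forall i : 'I_m, 0 < B i i) :
  ~ exists u : 'I_m -> 'rV[R]_N -> R -> R,
      [/\ classical_solution r B u, nonnegative u & nontrivial u].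
Proof.
move=> [u [usol u0 unt]]; apply: (liouville hN hr hp Bsym _ Bdiag usol u0 unt).
by move=> i j; have [->|ij] := eqVneq i j; [exact/ltW|exact: Boff].
Qed.
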